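(* Let $\theta$ be an inner function and let $G\in L^2$. If $\ker A^\theta_G$ contains both the functions \[ k^\theta_0=1-\overline{\theta(0)}\,\theta \qquad\text{and}\qquad \widetilde k^\theta_0= S^*\theta=\frac{\theta-\theta(0)}{z}, \] then $\ker A^\theta_G= K_\theta$ (that is, $A^\theta_G$ is the zero operator).
   Context: $L^2=L^2(\mathbb T)$, where $\mathbb T$ is the unit circle; $H^2_+=H^2(\mathbb D)$ and $H^\infty$ are the Hardy spaces of the disc, identified with boundary functions. For $\theta$ inner, $K_\theta=H^2_+\ominus\theta H^2_+$ is the model space and $P_\theta$ is the orthogonal projection of $L^2$ onto $K_\theta$. For $G\in L^2$, the truncated Toeplitz operator $A^\theta_G$ is the densely defined operator in $K_\theta$ given by $A^\theta_G f=P_\theta(Gf)$ for $f\in K_\theta\cap H^\infty$; if it is bounded, it is identified with its unique bounded extension to $K_\theta$. For $G\in L^\infty$ this is $A^\theta_G f=P_\theta(Gf)$ for all $f\in K_\theta$. Both $k^\theta_0$ and $\widetilde k^\theta_0$ lie in $K_\theta\cap H^\infty$. The statement $\ker A^\theta_G=K_\theta$ means that $A^\theta_G$ vanishes on $K_\theta\cap H^\infty$, and hence its bounded extension is zero on $K_\theta$. $S^*$ is the backward shift on $H^2_+$. *)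

(* Defs.v *)
From HB Require Import structures.
From mathcomp Require Import all_boot all_order all_algebra.
From mathcomp Require Import complex.
From mathcomp Require Import all_classical all_reals all_analysis.

Set Implicit Arguments.
Unset Strict Implicit.
Unset Printing Implicit Defensive.

Import Order.TTheory GRing.Theory Num.Theory.
Import numFieldNormedType.Exports.
Import ComplexField.Normc.

Local Open Scope classical_set_scope.
Local Open Scope ring_scope.
Local Open Scope complex_scope.

(* A function on the unit circle T is encoded by a function of the angle t,
   which stands for the point e^(it); only its values on [0, 2 pi[ matter, and
   T carries the normalized Lebesgue measure dt / (2 pi).  Spaces of functions
   are sets of (Borel measurable) representatives of a.e. classes. *)
Section Circle.
Variable R : realType.
Implicit Types (f g h u p theta G : R -> R[i]) (t : R) (w : R[i]).

Definition circle : set R := `[0, 2 * pi[.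

Definition zeta t : R[i] := cos t +i* sin t.

Definition mean f : R[i] :=
  ((2 * pi)^-1 * \int[lebesgue_measure]_(t in circle) complex.Re (f t)) +i*
  ((2 * pi)^-1 * \int[lebesgue_measure]_(t in circle) complex.Im (f t)).

Definition measurable_cfun f : Prop :=
  measurable_fun circle (fun t => complex.Re (f t)) /\
  measurable_fun circle (fun t => complex.Im (f t)).

Definition L2 : set (R -> R[i]) := [set f | measurable_cfun f /\
  lebesgue_measure.-integrable circle (fun t => (normc (f t) ^+ 2)%:E)].

Definition dotp f g : R[i] := mean (fun t => f t * (g t)^*).

Definition L2norm f : R := Num.sqrt
  ((2 * pi)^-1 * \int[lebesgue_measure]_(t in circle) (normc (f t) ^+ 2)).

Definition L2cvg (f_ : nat -> R -> R[i]) f : Prop :=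
  L2norm (f_ n \- f) @[n --> \oo] --> (0 : R).

Definition fourier f (n : int) : R[i] := dotp f (fun t => zeta t ^ n).

(* Hardy space of the disc, identified with boundary functions: the function
   sum_n a_n w^n with (a_n) square summable has the boundary function of L^2
   whose Fourier coefficients are a_n for 0 <= n and 0 for n < 0. *)
Definition H2 : set (R -> R[i]) :=
  [set f | L2 f /\ forall n : int, n < 0 -> fourier f n = 0].

Definition Hinf : set (R -> R[i]) :=
  [set f | H2 f /\ exists M : R,
     {ae lebesgue_measure, forall t, circle t -> normc (f t) <= M}].

(* the analytic function on the disc with boundary function f, for f in H^2 *)
Definition disc_fun f w : R[i] :=
  limn (series (fun n : nat => fourier f n%:Z * w ^+ n : R[i]^o)).

Definition ev0 f : R[i] := disc_fun f 0.

Definition inner_function theta : Prop := Hinf theta /\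
  {ae lebesgue_measure, forall t, circle t -> normc (theta t) = 1}.

Definition bshift f : R -> R[i] := fun t => (f t - ev0 f) / zeta t.

Definition model_space theta : set (R -> R[i]) :=
  [set f | H2 f /\ forall g, H2 g -> dotp f (theta \* g) = 0].

(* p = P_theta u, up to a.e. equality *)
Definition is_model_proj theta u p : Prop :=
  model_space theta p /\
  forall g, model_space theta g -> dotp (u \- p) g = 0.

(* graph of f |-> P_theta (G f) on its initial domain *)
Definition TTO0 theta G f h : Prop :=
  [/\ model_space theta f, Hinf f & is_model_proj theta (G \* f) h].

Definition TTO_bounded theta G : Prop :=
  exists C : R, forall f h, TTO0 theta G f h -> L2norm h <= C * L2norm f.

(* graph of the truncated Toeplitz operator: when the operator above is
   bounded, it is replaced by its extension by continuity to K_theta *)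
Definition TTO theta G f h : Prop :=
  TTO0 theta G f h \/
  [/\ TTO_bounded theta G, model_space theta f, model_space theta h &
     exists f_ h_ : nat -> R -> R[i],
       [/\ forall n, TTO0 theta G (f_ n) (h_ n), L2cvg f_ f & L2cvg h_ h]].

Definition ker_TTO theta G : set (R -> R[i]) :=
  [set f | TTO theta G f (fun=> 0)].

Definition model_kernel0 theta : R -> R[i] :=
  fun t => 1 - (ev0 theta)^* * theta t.

Definition model_conj_kernel0 theta : R -> R[i] := bshift theta.

End Circle.

(* Main.v *)
Require Import Defs.
From mathcomp Require Import all_boot all_order all_algebra.
From mathcomp Require Import complex.
From mathcomp Require Import all_classical all_reals all_analysis.
From mathcomp Require Import measurable_realfun.
From mathcomp Require Import ring lra zify.

Set Implicit Arguments.
Unset Strict Implicit.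
Unset Printing Implicit Defensive.

Import Order.TTheory GRing.Theory Num.Theory.
Import numFieldNormedType.Exports.
Import ComplexField.Normc.

Local Open Scope classical_set_scope.
Local Open Scope complex_scope.
Local Open Scope ring_scope.

(** Let [B f g] be the mean of [G f conj(g)], for [f] and [g] bounded in
    [K = model_space theta].  The operator vanishes as soon as [B] does, because
    the bounded functions are dense in [K].  Let [V] ([ker_form]) be the space
    of the [f] with [B f g = 0] for all [g]; by hypothesis it contains the two
    kernels [k0] and [k1 = S^* theta].

    The main point ([cshift_ker]) is that [V] is stable under the compressed
    shift [S f = z f - c theta], where [c = <z f, theta>].  Every [g] in [K] is
    [g(0) + z S^* g], with [S^* g] in [K], and [|z| = 1], so for [f] in [V] the
    product [<G z f, g>] is [conj(g(0)) <G z f, 1>].  For [f = k1] this computes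
    [<G (theta - theta(0)), g>], and together with [B k0 g = 0] it shows that
    [(1 - |theta(0)|^2) <G theta, g>] is a multiple of [conj(g(0))] as well.
    Hence [B (S f) g = conj(g(0)) gamma] with [gamma] independent of [g].  The
    conjugation [C f = theta conj(z f)] of [K] maps [k0] to [k1] and satisfies
    [B f g = B (C g) (C f)], so [B f k0 = B k1 (C f) = 0] for all [f]
    ([form_kernel0]).  Since [k0(0) = 1 - |theta(0)|^2], taking [g = k0] gives
    [gamma = 0], unless [|theta(0)| = 1]; but then [theta] is constant and
    [K] is zero ([model_space_trivial]).

    It remains to see that [k0] is cyclic for [S] ([kernel0_cyclic]).  By
    induction on [n], [z^n] is the sum of an element of [V] and of [theta]
    times a polynomial.  The second term is orthogonal to [K], so approximating
    an element of [K] by polynomials approximates it by elements of [V].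
    Polynomials are dense in [H2] because trigonometric polynomials are dense in
    [L2] ([trig_dense]): they approximate the indicator of a half-line, thus of
    a Borel set by a Dynkin class argument, thus simple functions. *)

(** * Almost everywhere statements *)

Lemma ae_forall (R : realType) (P : R -> Prop) : (forall t, P t) ->
  {ae @lebesgue_measure R, forall t, P t}.
Proof.
move=> p; have F := ae_filter_ringOfSetsType (@lebesgue_measure R).
apply: (@filterS _ _ F setT) => [t _|]; first exact: p.
exact: (@filterT _ _ F).
Qed.

Lemma ae_imply (R : realType) (P Q : R -> Prop) : (forall t, P t -> Q t) ->
  {ae @lebesgue_measure R, forall t, P t} ->
  {ae @lebesgue_measure R, forall t, Q t}.
Proof.
exact: (@filterS _ _ (ae_filter_ringOfSetsType (@lebesgue_measure R))).
Qed.

Lemma ae_imply2 (R : realType) (P Q S : R -> Prop) :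
  (forall t, P t -> Q t -> S t) ->
  {ae @lebesgue_measure R, forall t, P t} ->
  {ae @lebesgue_measure R, forall t, Q t} ->
  {ae @lebesgue_measure R, forall t, S t}.
Proof.
exact: (@filterS2 _ _ (ae_filter_ringOfSetsType (@lebesgue_measure R))).
Qed.

(** * The inner product of the circle *)

Section L2_space.
Variable R : realType.
Implicit Types (f g h u v : R -> R[i]) (c z w : R[i]).
Local Notation mu := (@lebesgue_measure R).
Local Notation T := (@circle R).

Lemma normc_ge0 z : 0 <= normc z.
Proof. by case: z => a b; exact: sqrtr_ge0. Qed.

Lemma normc_sqr z : normc z ^+ 2 = complex.Re z ^+ 2 + complex.Im z ^+ 2.
Proof. by case: z => a b; rewrite sqr_sqrtr// addr_ge0 ?sqr_ge0. Qed.

Lemma normc_conj z : normc z^* = normc z.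
Proof. by case: z => a b; rewrite /normc /= sqrrN. Qed.

Lemma mulJc z : z * z^* = (normc z ^+ 2)%:C.
Proof.
rewrite normc_sqr; case: z => a b; apply/eqP; rewrite eq_complex /=.
by apply/andP; split; apply/eqP; ring.
Qed.

Lemma normc_real (a : R) : normc a%:C = `|a|.
Proof. by rewrite /= expr0n addr0 sqrtr_sqr. Qed.

Lemma Re_le_normc z : `|complex.Re z| <= normc z.
Proof.
by rewrite -(@ler_pXn2r _ 2) ?nnegrE ?normc_ge0// real_normK ?num_real//
  normc_sqr lerDl sqr_ge0.
Qed.

Lemma Im_le_normc z : `|complex.Im z| <= normc z.
Proof.
by rewrite -(@ler_pXn2r _ 2) ?nnegrE ?normc_ge0// real_normK ?num_real//
  normc_sqr lerDr sqr_ge0.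
Qed.

Lemma ReD z w : complex.Re (z + w) = complex.Re z + complex.Re w.
Proof. by case: z w => [a b] [c d]. Qed.
Lemma ImD z w : complex.Im (z + w) = complex.Im z + complex.Im w.
Proof. by case: z w => [a b] [c d]. Qed.
Lemma ReM z w : complex.Re (z * w) =
  complex.Re z * complex.Re w - complex.Im z * complex.Im w.
Proof. by case: z w => [a b] [c d]. Qed.
Lemma ImM z w : complex.Im (z * w) =
  complex.Re z * complex.Im w + complex.Im z * complex.Re w.
Proof. by case: z w => [a b] [c d]. Qed.
Lemma ReJ z : complex.Re z^* = complex.Re z. Proof. by case: z. Qed.
Lemma ImJ z : complex.Im z^* = - complex.Im z. Proof. by case: z. Qed.

Lemma complex_ext z w :
  complex.Re z = complex.Re w -> complex.Im z = complex.Im w -> z = w.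
Proof. by case: z w => [a b] [c d] /= -> ->. Qed.

Definition conjf f : R -> R[i] := fun t => (f t)^*.

Lemma measurable_circle : measurable T.
Proof. exact: measurable_itv. Qed.
Local Hint Resolve measurable_circle : core.

Lemma pi2_gt0 : 0 < 2 * pi :> R.
Proof. by rewrite mulr_gt0// pi_gt0. Qed.

Lemma circle_measure : mu T = (2 * pi)%:E.
Proof.
by rewrite /circle lebesgue_measure_itv /= lte_fin pi2_gt0 oppr0 adde0.
Qed.

Lemma mcfun_cst c : measurable_cfun (cst c).
Proof. by split; exact: measurable_cst. Qed.

Lemma mcfunD f g : measurable_cfun f -> measurable_cfun g ->
  measurable_cfun (f \+ g).
Proof.
move=> [f1 f2] [g1 g2]; split.
  by under eq_fun do rewrite ReD; exact: measurable_funD.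
by under eq_fun do rewrite ImD; exact: measurable_funD.
Qed.

Lemma mcfunM f g : measurable_cfun f -> measurable_cfun g ->
  measurable_cfun (f \* g).
Proof.
move=> [f1 f2] [g1 g2]; split.
  by under eq_fun do rewrite ReM; apply: measurable_funB;
    exact: measurable_funM.
by under eq_fun do rewrite ImM; apply: measurable_funD; exact: measurable_funM.
Qed.

Lemma mcfunJ f : measurable_cfun f -> measurable_cfun (conjf f).
Proof.
move=> [f1 f2]; split; first by under eq_fun do rewrite ReJ.
by under eq_fun do rewrite ImJ; exact: measurableT_comp.
Qed.

Lemma mcfun_sqr f : measurable_cfun f ->
  measurable_fun T (fun t => normc (f t) ^+ 2).
Proof.
move=> [f1 f2]; under eq_fun do rewrite normc_sqr.
by apply: measurable_funD; exact: measurable_funX.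
Qed.

Lemma mcfun_normc f : measurable_cfun f ->
  measurable_fun T (fun t => normc (f t)).
Proof.
move=> /mcfun_sqr mf.
under eq_fun do rewrite -[normc _]ger0_norm ?normc_ge0// -sqrtr_sqr.
apply: (measurableT_comp (f := @Num.sqrt R)) mf.
apply: continuous_measurable_fun; exact: sqrt_continuous.
Qed.

Lemma le_integrable_real (a b : R -> R) : measurable_fun T a ->
  (forall t, T t -> `|a t| <= b t) ->
  mu.-integrable T (fun t => (b t)%:E) -> mu.-integrable T (fun t => (a t)%:E).
Proof.
move=> ma ab; apply: le_integrable => //; first exact/measurable_EFinP.
by move=> t Tt /=; rewrite lee_fin (le_trans (ab _ Tt))// ler_norm.
Qed.

Definition L1 f := measurable_cfun f /\
  mu.-integrable T (fun t => (normc (f t))%:E).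

Lemma L1_Re f : L1 f -> mu.-integrable T (fun t => (complex.Re (f t))%:E).
Proof.
by move=> [[f1 f2]]; apply: le_integrable_real => // t _; exact: Re_le_normc.
Qed.

Lemma L1_Im f : L1 f -> mu.-integrable T (fun t => (complex.Im (f t))%:E).
Proof.
by move=> [[f1 f2]]; apply: le_integrable_real => // t _; exact: Im_le_normc.
Qed.

Lemma L1_le f (b : R -> R) : measurable_cfun f ->
  (forall t, T t -> normc (f t) <= b t) ->
  mu.-integrable T (fun t => (b t)%:E) -> L1 f.
Proof.
move=> mf fb ib; split => //; apply: le_integrable_real ib.
  exact: mcfun_normc.
by move=> t Tt; rewrite ger0_norm ?normc_ge0// fb.
Qed.

Lemma integrableD_real (a b : R -> R) : mu.-integrable T (fun t => (a t)%:E) ->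
  mu.-integrable T (fun t => (b t)%:E) ->
  mu.-integrable T (fun t => (a t + b t)%:E).
Proof. by move=> ia ib; under eq_fun do rewrite EFinD; exact: integrableD. Qed.

Lemma integrableZ_real (k : R) (a : R ->
  R) : mu.-integrable T (fun t => (a t)%:E) ->
  mu.-integrable T (fun t => (k * a t)%:E).
Proof. by move=> ia; under eq_fun do rewrite EFinM; exact: integrableZl. Qed.

Lemma meanD f g : L1 f -> L1 g -> mean (f \+ g) = mean f + mean g.
Proof.
move=> f1 g1; apply: complex_ext => /=; rewrite -mulrDr; congr (_ * _).
  under eq_Rintegral do rewrite ReD.
  by rewrite RintegralD//; exact: L1_Re.
under eq_Rintegral do rewrite ImD.
by rewrite RintegralD//; exact: L1_Im.
Qed.

Lemma meanZ c f : L1 f -> mean (cst c \* f) = c * mean f.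
Proof.
move=> f1; have iR := L1_Re f1; have iI := L1_Im f1.
apply: complex_ext; rewrite ?ReM ?ImM /=.
  under eq_Rintegral do rewrite ReM.
  rewrite RintegralB ?RintegralZl//;
    [ring|exact: integrableZ_real|exact: integrableZ_real].
under eq_Rintegral do rewrite ImM.
rewrite RintegralD ?RintegralZl//;
  [ring|exact: integrableZ_real|exact: integrableZ_real].
Qed.

Lemma meanJ f : L1 f -> mean (conjf f) = (mean f)^*.
Proof.
move=> f1; have iI := L1_Im f1; apply: complex_ext => /=.
  by under eq_Rintegral do rewrite ReJ.
under eq_Rintegral do rewrite ImJ -mulN1r.
by rewrite RintegralZl//; ring.
Qed.

Lemma mean_cst c : mean (cst c) = c.
Proof.
have muT : fine (mu T) = 2 * pi by rewrite circle_measure.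
have pi20 : 2 * pi != 0 :> R by rewrite gt_eqF// pi2_gt0.
by apply: complex_ext => /=; rewrite Rintegral_cst// muT mulrCA mulVf ?mulr1.
Qed.

Lemma mean_ae f g : measurable_cfun f -> measurable_cfun g ->
  {ae mu, forall t, T t -> f t = g t} -> mean f = mean g.
Proof.
move=> [f1 f2] [g1 g2] fg.
rewrite /mean /Rintegral; congr ((_ * fine _) +i* (_ * fine _)).
- apply: ae_eq_integral => //; [exact/measurable_EFinP|exact/measurable_EFinP|].
  by apply: ae_imply fg => t + Tt => ->.
- apply: ae_eq_integral => //; [exact/measurable_EFinP|exact/measurable_EFinP|].
  by apply: ae_imply fg => t + Tt => ->.
Qed.

Lemma integrable_cst_circle (k : R) : mu.-integrable T (fun=> k%:E).
Proof.
apply/integrableP; split; first exact: measurable_cst.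
rewrite integral_cst//; change (`|k%:E| * mu T < +oo)%E.
by rewrite circle_measure -EFinM ltry.
Qed.

Definition Linf f := measurable_cfun f /\
  exists M : R, {ae mu, forall t, T t -> normc (f t) <= M}.

Lemma Linf_cst c : Linf (cst c).
Proof. by split; [exact: mcfun_cst|exists (normc c); apply: ae_forall => t _;
  exact: lexx]. Qed.

Lemma LinfJ f : Linf f -> Linf (conjf f).
Proof.
move=> [mf [M fM]]; split; first exact: mcfunJ.
by exists M; apply: ae_imply fM => t /[apply]; rewrite normc_conj.
Qed.

Lemma LinfD f g : Linf f -> Linf g -> Linf (f \+ g).
Proof.
move=> [mf [M fM]] [mg [N gN]]; split; first exact: mcfunD.
exists (M + N); apply: ae_imply2 fM gN => t fM gN Tt.
by apply: le_trans (le_normcD _ _) _; apply: lerD; [exact: fM|exact: gN].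
Qed.

Lemma LinfM f g : Linf f -> Linf g -> Linf (f \* g).
Proof.
move=> [mf [M fM]] [mg [N gN]]; split; first exact: mcfunM.
exists (M * N); apply: ae_imply2 fM gN => t fM gN Tt; rewrite normcM.
by apply: ler_pM; rewrite ?normc_ge0//; [exact: fM|exact: gN].
Qed.

Lemma L2M h f : Linf h -> L2 f -> L2 (h \* f).
Proof.
move=> [mh [M hM]] [mf /integrableP[_ fi]]; split; first exact: mcfunM.
have mhf2 : measurable_fun T (fun t => (normc ((h \* f) t) ^+ 2)%:E).
  by apply/measurable_EFinP; apply: mcfun_sqr; exact: mcfunM.
apply/integrableP; split => //; have mf2 := mcfun_sqr mf.
have ifM : mu.-integrable T (fun t => (M ^+ 2 * normc (f t) ^+ 2)%:E).
  by apply: integrableZ_real; apply/integrableP; split => //;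
    exact/measurable_EFinP.
have /integrableP[_] := ifM; apply: le_lt_trans.
apply: ae_ge0_le_integral => //.
- exact: measurableT_comp.
- by apply: measurableT_comp => //; apply/measurable_EFinP;
    exact: measurable_funM.
apply: ae_imply hM => t /[apply] hMt.
have M0 : 0 <= M by exact: le_trans (normc_ge0 _) hMt.
rewrite /= lee_fin ger0_norm ?sqr_ge0// ger0_norm; last first.
  by rewrite mulr_ge0 ?sqr_ge0.
rewrite normcM exprMn ler_wpM2r ?sqr_ge0//.
by rewrite ler_pXn2r// nnegrE normc_ge0.
Qed.

Lemma normcD_sqr z w : normc (z + w) ^+ 2 <= 2 * normc z ^+ 2 + 2 * normc w ^+
  2.
Proof.
case: z w => [a b] [c d]; rewrite !normc_sqr /=.
have := sqr_ge0 (a - c); have := sqr_ge0 (b - d); nra.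
Qed.

Lemma L2D f g : L2 f -> L2 g -> L2 (f \+ g).
Proof.
move=> [mf fi] [mg gi]; split; first exact: mcfunD.
have := integrableD_real (integrableZ_real 2 fi) (integrableZ_real 2 gi).
apply: le_integrable_real; first exact: (mcfun_sqr (mcfunD mf mg)).
by move=> t _; rewrite ger0_norm ?sqr_ge0// normcD_sqr.
Qed.

Lemma Linf_L2 f : Linf f -> L2 f.
Proof.
move=> fb; have -> : f = f \* cst 1 by apply/funext => t /=; rewrite mulr1.
apply: L2M => //; split; first exact: mcfun_cst.
exact: (integrable_cst_circle (normc (1 : R[i]) ^+ 2)).
Qed.

Lemma L2Z c f : L2 f -> L2 (cst c \* f).
Proof. by apply: L2M; exact: Linf_cst. Qed.

Lemma L2Mr g f : L2 g -> Linf f -> L2 (g \* f).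
Proof.
move=> g2 fb; rewrite (_ : g \* f = f \* g); first exact: L2M.
by apply/funext => t /=; rewrite mulrC.
Qed.

Lemma L2_cst c : L2 (cst c). Proof. exact/Linf_L2/Linf_cst. Qed.

Lemma fun_subE f g : f \- g = f \+ (cst (-1) \* g).
Proof. by apply/funext => t /=; rewrite mulN1r. Qed.

Lemma L2B f g : L2 f -> L2 g -> L2 (f \- g).
Proof. by move=> f2 g2; rewrite fun_subE; apply: L2D => //; exact: L2Z. Qed.

Lemma LinfB f g : Linf f -> Linf g -> Linf (f \- g).
Proof.
by move=> f2 g2; rewrite fun_subE; apply: LinfD => //; apply: LinfM => //;
  exact: Linf_cst.
Qed.

Lemma L2J f : L2 f -> L2 (conjf f).
Proof.
move=> [mf fi]; split; first exact: mcfunJ.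
by rewrite /conjf; under eq_fun do rewrite normc_conj.
Qed.

Lemma L1_dot f g : L2 f -> L2 g -> L1 (f \* conjf g).
Proof.
move=> [mf fi] [mg gi].
apply: L1_le (integrableD_real fi gi); first by apply: mcfunM => //;
  exact: mcfunJ.
move=> t _; rewrite normcM normc_conj.
by have := normc_ge0 (f t); have := normc_ge0 (g t); nra.
Qed.

Lemma dotpE f g : dotp f g = mean (f \* conjf g). Proof. by []. Qed.

Lemma dotpC f g : L2 f -> L2 g -> dotp g f = (dotp f g)^*.
Proof.
move=> f2 g2; rewrite !dotpE -meanJ; last exact: L1_dot.
by congr mean; apply/funext => t; rewrite /conjf /= rmorphM /= conjCK mulrC.
Qed.

Lemma dotpDl f g h : L2 f -> L2 g -> L2 h ->
  dotp (f \+ g) h = dotp f h + dotp g h.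
Proof.
move=> f2 g2 h2; rewrite !dotpE -meanD; try exact: L1_dot.
by congr mean; apply/funext => t /=; rewrite mulrDl.
Qed.

Lemma dotpZl c f h : L2 f -> L2 h -> dotp (cst c \* f) h = c * dotp f h.
Proof.
move=> f2 h2; rewrite !dotpE -meanZ; last exact: L1_dot.
by congr mean; apply/funext => t /=; rewrite mulrA.
Qed.

Lemma dotpBl f g h : L2 f -> L2 g -> L2 h ->
  dotp (f \- g) h = dotp f h - dotp g h.
Proof.
by move=> f2 g2 h2; rewrite fun_subE dotpDl// ?dotpZl ?mulN1r//; exact: L2Z.
Qed.

Lemma dotpDr f g h : L2 f -> L2 g -> L2 h ->
  dotp h (f \+ g) = dotp h f + dotp h g.
Proof.
move=> f2 g2 h2; rewrite dotpC ?dotpDl ?rmorphD/=//; last exact: L2D.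
by rewrite (dotpC f2 h2) ?(dotpC g2 h2).
Qed.

Lemma dotpZr c f h : L2 f -> L2 h -> dotp h (cst c \* f) = c^* * dotp h f.
Proof.
move=> f2 h2; rewrite dotpC ?dotpZl ?rmorphM/=//; last exact: L2Z.
by rewrite (dotpC f2 h2).
Qed.

Lemma dotpBr f g h : L2 f -> L2 g -> L2 h ->
  dotp h (f \- g) = dotp h f - dotp h g.
Proof.
move=> f2 g2 h2; rewrite fun_subE dotpDr// ?dotpZr// ?rmorphN ?rmorph1
  ?mulN1r//; exact: L2Z.
Qed.

Lemma dotp_mull h f g : dotp (h \* f) g = dotp f (conjf h \* g).
Proof.
rewrite !dotpE; congr mean; apply/funext => t.
by rewrite /conjf /= rmorphM /= conjCK; ring.
Qed.

Lemma dotp_ae f g f' g' : L2 f -> L2 g -> L2 f' -> L2 g' ->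
  {ae mu, forall t, T t -> f t * (g t)^* = f' t * (g' t)^*} ->
  dotp f g = dotp f' g'.
Proof.
by move=> f2 g2 f2' g2'; apply: mean_ae; apply: (proj1 (L1_dot _ _)).
Qed.

(** The squared norm: it adds up over orthogonal sums and involves no square
    root. *)
Definition N2 f : R := (2 * pi)^-1 * \int[mu]_(t in T) (normc (f t) ^+ 2).

Lemma pi2V_ge0 : 0 <= (2 * pi)^-1 :> R.
Proof. by rewrite invr_ge0 ltW// pi2_gt0. Qed.

Lemma N2_ge0 f : 0 <= N2 f.
Proof. by rewrite mulr_ge0 ?pi2V_ge0// Rintegral_ge0// => t _;
  exact: sqr_ge0. Qed.

Lemma dotpff f : dotp f f = (N2 f)%:C.
Proof.
rewrite /N2; apply: complex_ext => /=.
  congr (_ * _).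
  by apply: eq_Rintegral => t _; rewrite mulJc.
rewrite -[RHS](mulr0 (2 * pi)^-1); congr (_ * _).
under eq_Rintegral do rewrite mulJc.
by rewrite /= Rintegral_cst// mul0r.
Qed.

Lemma N2_le f (b : R -> R) : L2 f -> mu.-integrable T (fun t => (b t)%:E) ->
  (forall t, T t -> normc (f t) ^+ 2 <= b t) ->
  N2 f <= (2 * pi)^-1 * \int[mu]_(t in T) b t.
Proof. by move=> [mf fi] bi fb; rewrite ler_wpM2l ?pi2V_ge0// le_Rintegral. Qed.

(** Up to the constant [2], this is all that is needed of the triangle
    inequality, and it holds under the integral sign. *)
Lemma N2D_le f g : L2 f -> L2 g -> N2 (f \+ g) <= 2 * N2 f + 2 * N2 g.
Proof.
move=> f2 g2; have [_ fi] := f2; have [_ gi] := g2.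
have fi2 := integrableZ_real 2 fi; have gi2 := integrableZ_real 2 gi.
have := @N2_le _ _ (L2D f2 g2) (integrableD_real fi2 gi2) _.
rewrite RintegralD// !RintegralZl// mulrDr !(mulrCA _ 2); apply => t _.
exact: normcD_sqr.
Qed.

Lemma N2Z c f : L2 f -> N2 (cst c \* f) = normc c ^+ 2 * N2 f.
Proof.
move=> [mf fi]; rewrite /N2 /=; under eq_Rintegral do rewrite normcM exprMn.
by rewrite RintegralZl// mulrCA.
Qed.

Lemma N2D_orth f g : L2 f -> L2 g -> dotp f g = 0 -> N2 (f \+ g) = N2 f + N2 g.
Proof.
move=> f2 g2 fg; apply: complexI; rewrite rmorphD /= -!dotpff.
have gf : dotp g f = 0 by rewrite (dotpC f2 g2) fg rmorph0.
have fg2 := L2D f2 g2.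
by rewrite dotpDl// !dotpDr// fg gf addr0 add0r.
Qed.

(** A weighted form of the Cauchy-Schwarz inequality, obtained by integrating
    [2 a b <= s a^2 + b^2 / s];
      a large weight [s] makes the second term small, and
    the first one is then controlled by [N2 f]. *)
Lemma dotp_le (s : R) f g : 0 < s -> L2 f -> L2 g ->
  normc (dotp f g) <= s * N2 f + s^-1 * N2 g.
Proof.
move=> s0 f2 g2; have [mf fi] := f2; have [mg gi] := g2.
have [_ fg1] := L1_dot f2 g2.
have sV : 0 < s^-1 by rewrite invr_gt0.
have aux (a b : R) : 2 * (a * b) <= s * a ^+ 2 + s^-1 * b ^+ 2.
  have -> : s * a ^+ 2 + s^-1 * b ^+ 2 = s * (a - s^-1 * b) ^+ 2 + 2 * (a * b).
    by field; rewrite gt_eqF.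
  by rewrite lerDr mulr_ge0 ?sqr_ge0// ltW.
have I := integrableD_real (integrableZ_real s fi) (integrableZ_real s^-1 gi).
have key (phi : R[i] -> R) : (forall z, `|phi z| <= normc z) ->
    mu.-integrable T (fun t => (phi (f t * (g t)^*))%:E) ->
    `|(2 * pi)^-1 * \int[mu]_(t in T) phi (f t * (g t)^*)|
    <= (s * N2 f + s^-1 * N2 g) / 2.
  move=> phin iphi; rewrite normrM ger0_norm ?pi2V_ge0//.
  rewrite ler_pdivlMr// -mulrA.
  have <- : (2 * pi)^-1 * \int[mu]_(t in T)
      (s * normc (f t) ^+ 2 + s^-1 * normc (g t) ^+ 2) = s * N2 f + s^-1 * N2 g.
    rewrite RintegralD//; [|exact: integrableZ_real|exact: integrableZ_real].
    by rewrite !RintegralZl// /N2; ring.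
  rewrite ler_wpM2l ?pi2V_ge0// mulrC.
  apply: le_trans (ler_wpM2l _ (le_normr_Rintegral _ iphi)) _ => //.
  have iphi' : mu.-integrable T (fun t => (`|phi (f t * (g t)^*)|)%:E).
    exact: (integrable_norm iphi).
  rewrite -RintegralZl//; apply: le_Rintegral => //;
    first exact: integrableZ_real.
  move=> t _; apply: le_trans (aux (normc (f t)) (normc (g t))).
  by rewrite ler_wpM2l// (le_trans (phin _))// normcM normc_conj.
have kR := key _ Re_le_normc (L1_Re (L1_dot f2 g2)).
have kI := key _ Im_le_normc (L1_Im (L1_dot f2 g2)).
have -> : dotp f g = (complex.Re (dotp f g))%:C + 'i%C * (complex.Im (dotp f
  g))%:C.
  exact: complexE.
apply: le_trans (le_normcD _ _) _; rewrite normcM !normc_real.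
have -> : normc ('i%C : R[i]) = 1 by rewrite /= expr0n add0r expr1n sqrtr1.
rewrite mul1r; apply: le_trans (lerD kR kI) _; lra.
Qed.

Lemma dotp_small g (e : R) : L2 g -> 0 < e ->
  exists2 d : R, 0 < d & forall f, L2 f -> N2 f < d -> normc (dotp f g) < e.
Proof.
move=> g2 e0.
have s0 : 0 < 2 * (N2 g + 1) / e by rewrite divr_gt0// mulr_gt0// ltr_wpDl//
  N2_ge0.
exists (e / 2 / (2 * (N2 g + 1) / e)); first by apply: divr_gt0 => //;
  exact: divr_gt0.
move=> f f2 fd; apply: le_lt_trans (dotp_le s0 f2 g2) _.
rewrite [ltRHS](splitr e); apply: ltr_leD.
  by rewrite mulrC -ltr_pdivlMr.
rewrite invf_div mulrAC ler_pdivrMr ?mulr_gt0 ?ltr_wpDl ?N2_ge0//.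
by move: e0; lra.
Qed.

Lemma dotp_N2_0 f g : L2 f -> L2 g -> N2 f = 0 -> dotp f g = 0.
Proof.
move=> f2 g2 f0; apply: eq0_normc; apply/eqP; rewrite eq_le normc_ge0 andbT.
apply/ler_addgt0Pr => e e0; rewrite add0r.
have [d d0 /(_ f f2)] := dotp_small g2 e0.
by rewrite f0 => /(_ d0)/ltW.
Qed.

(** Closure for the [L2] norm, which the squared norm defines just as well. *)
Definition adherent (V : set (R -> R[i])) f :=
  forall e, 0 < e -> exists p, V p /\ N2 (f \- p) < e.

(** Orthogonality to [g] is a closed condition, by [dotp_small]. *)
Lemma dotp_adherent (V : set (R -> R[i])) f g : L2 f -> L2 g -> adherent V f ->
  (forall p, V p -> L2 p /\ dotp p g = 0) -> dotp f g = 0.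
Proof.
move=> f2 g2 Vf Vg; apply: eq0_normc; apply/eqP; rewrite eq_le normc_ge0 andbT.
apply/ler_addgt0Pr => e e0; rewrite add0r.
have [d d0 small] := dotp_small g2 e0.
have [p [/Vg[p2 pg] fp]] := Vf d d0.
have <- : dotp (f \- p) g = dotp f g by rewrite dotpBl// pg subr0.
by apply/ltW/small => //; exact: L2B.
Qed.

Lemma adherentD (V : set (R -> R[i])) f g : L2 f -> L2 g ->
  (forall p, V p -> L2 p) -> (forall p q, V p -> V q -> V (p \+ q)) ->
  adherent V f -> adherent V g -> adherent V (f \+ g).
Proof.
move=> f2 g2 V2 VD Vf Vg e e0.
have e4 : 0 < e / 4 by rewrite divr_gt0.
have [p [Vp fp]] := Vf _ e4; have [q [Vq gq]] := Vg _ e4.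
exists (p \+ q); split; first exact: VD.
have -> : (f \+ g) \- (p \+ q) = (f \- p) \+ (g \- q).
  by apply/funext => t /=; ring.
apply: le_lt_trans (N2D_le (L2B f2 (V2 _ Vp)) (L2B g2 (V2 _ Vq))) _; lra.
Qed.

Lemma adherentZ (V : set (R -> R[i])) c f : L2 f ->
  (forall p, V p -> L2 p) -> (forall p, V p -> V (cst c \* p)) ->
  adherent V f -> adherent V (cst c \* f).
Proof.
move=> f2 V2 VZ Vf e e0.
have n0 : 0 < normc c ^+ 2 + 1 by rewrite ltr_wpDl// sqr_ge0.
have [p [Vp fp]] := Vf _ (divr_gt0 e0 n0).
exists (cst c \* p); split; first exact: VZ.
have -> : (cst c \* f) \- (cst c \* p) = cst c \* (f \- p).
  by apply/funext => t /=; ring.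
rewrite N2Z; last exact: L2B (V2 _ Vp).
move: fp; rewrite ltr_pdivlMr//; have := N2_ge0 (f \- p); nra.
Qed.

Lemma adherent_adherent (V : set (R -> R[i])) f : L2 f ->
  (forall p, V p -> L2 p) -> adherent [set g | L2 g /\ adherent V g] f ->
  adherent V f.
Proof.
move=> f2 V2 Vf e e0; have e4 : 0 < e / 4 by rewrite divr_gt0.
have [g [[g2 Vg] fg]] := Vf _ e4; have [p [Vp gp]] := Vg _ e4.
exists p; split => //.
have -> : f \- p = (f \- g) \+ (g \- p) by apply/funext => t /=; ring.
apply: le_lt_trans (N2D_le (L2B f2 g2) (L2B g2 (V2 _ Vp))) _; lra.
Qed.

Lemma adherent_mem (V : set (R -> R[i])) f : V f -> adherent V f.
Proof.
move=> Vf e e0; exists f; split => //; rewrite /N2.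
under eq_Rintegral do rewrite /= subrr normc0 expr0n.
by rewrite Rintegral_cst// mul0r mulr0.
Qed.

Lemma N2_eq0 f : (forall t, T t -> f t = 0) -> N2 f = 0.
Proof.
move=> f0; rewrite /N2.
have -> : \int[mu]_(t in T) (normc (f t) ^+ 2) = \int[mu]_(t in T) (0 : R).
  by apply: eq_Rintegral => t; rewrite inE => Tt; rewrite f0// normc0 expr0n.
by rewrite Rintegral_cst ?mul0r ?mulr0//; exact: measurable_circle.
Qed.

Lemma N2_L2norm f : L2norm f ^+ 2 = N2 f.
Proof. by rewrite sqr_sqrtr// N2_ge0. Qed.

(** Dominated convergence; the bound [b] is on the squared modulus. *)
Lemma N2_cvg0 (f_ : nat -> R -> R[i]) (b : R -> R) :
  (forall n, L2 (f_ n)) -> mu.-integrable T (fun t => (b t)%:E) ->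
  (forall n, {ae mu, forall t, T t -> normc (f_ n t) ^+ 2 <= b t}) ->
  {ae mu, forall t, T t -> normc (f_ n t) ^+ 2 @[n --> \oo] --> (0 : R)} ->
  N2 (f_ n) @[n --> \oo] --> (0 : R).
Proof.
move=> f2 bi fb f0.
rewrite -[X in _ --> X](mulr0 (2 * pi)^-1); apply: cvgM; first exact: cvg_cst.
have [] := @dominated_convergence _ _ R mu T measurable_circle
  (fun n t => (normc (f_ n t) ^+ 2)%:E) (cst 0%E) (fun t => (b t)%:E).
- by move=> n; apply/measurable_EFinP; exact: (mcfun_sqr (proj1 (f2 n))).
- exact: measurable_cst.
- by apply: ae_imply f0 => t + Tt => /(_ Tt) h; apply: cvg_EFin => //;
    exact: nearW.
- exact: bi.
- apply/ae_foralln => n; apply: ae_imply (fb n) => t + Tt => /(_ Tt).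
  by rewrite /= lee_fin ger0_norm// sqr_ge0.
move=> _ _; rewrite integral0 => h.
apply: fine_cvg; exact: h.
Qed.

End L2_space.

(** * Trigonometric polynomials *)

Section trigonometric_functions.
Variable R : realType.
Implicit Types (f g h u v : R -> R[i]) (c z w : R[i]).
Local Notation mu := (@lebesgue_measure R).
Local Notation T := (@circle R).

Definition mono (n : int) : R -> R[i] := fun t => zeta t ^ n.

Lemma normc_zeta (t : R) : normc (zeta t) = 1.
Proof. by rewrite /= cos2Dsin2 sqrtr1. Qed.

Lemma zeta_neq0 (t : R) : zeta t != 0.
Proof.
apply/eqP => z0; have := normc_zeta t; rewrite z0 normc0 => /eqP.
by rewrite eq_sym oner_eq0.
Qed.

Lemma zetaJ (t : R) : (zeta t)^* = (zeta t)^-1.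
Proof.
apply: (mulfI (zeta_neq0 t)); rewrite mulfV ?zeta_neq0//.
by rewrite mulJc normc_zeta expr1n.
Qed.

Lemma monoJ n : conjf (mono n) = mono (- n).
Proof.
by apply/funext => t; rewrite /conjf /mono fmorphXz /= zetaJ exprz_inv.
Qed.

Lemma monoD n m : mono n \* mono m = mono (n + m).
Proof. by apply/funext => t; rewrite /mono /= expfzDr// zeta_neq0. Qed.

Lemma mono0 : mono 0 = cst 1.
Proof. by apply/funext => t; rewrite /mono expr0z. Qed.

Lemma cst_mono0 c : cst c = cst c \* mono 0.
Proof. by rewrite mono0; apply/funext => t /=; rewrite mulr1. Qed.

Lemma mono1 : mono 1 = @zeta R.
Proof. by apply/funext => t; rewrite /mono expr1z. Qed.

Lemma Linf_mono n : Linf (mono n).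
Proof.
have Linf1 : Linf (mono 1).
  rewrite mono1; split.
    split => /=; apply: measurable_funTS; apply: continuous_measurable_fun.
      exact: continuous_cos.
    exact: continuous_sin.
  by exists 1; apply: ae_forall => t _; rewrite normc_zeta.
have Linfn (m : nat) : Linf (mono m%:Z).
  elim: m => [|m IH]; first by rewrite mono0; exact: Linf_cst.
  by rewrite -addn1 PoszD -monoD; exact: LinfM.
by case: n => m //; rewrite NegzE -monoJ; exact: LinfJ.
Qed.

Lemma L2_mono n : L2 (mono n). Proof. exact/Linf_L2/Linf_mono. Qed.

Lemma integral_circle_FTC (F f : R -> R) :
  (forall x : R, is_derive x 1 F (f x)) -> continuous f ->
  \int[mu]_(t in T) f t = F (2 * pi) - F 0.
Proof.
move=> dF cf; have p0 := pi2_gt0 R.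
have cF : continuous F.
  move=> x; apply/differentiable_continuous/derivable1_diffP.
  by have [] := dF x.
rewrite /circle Rintegral_itv_bndo_bndc; last first.
  have : mu.-integrable `[0, 2 * pi] (EFin \o f).
    by apply: continuous_compact_integrable;
      [exact: segment_compact|exact: continuous_subspaceT].
  apply: integrableS => //; exact: subset_itv_co_cc.
rewrite /Rintegral (@continuous_FTC2 _ f F)//.
- exact: continuous_subspaceT.
- split.
  + by move=> x _; have [] := dF x.
  + exact/cvg_at_right_filter/cF.
  + exact/cvg_at_left_filter/cF.
- by move=> x _; rewrite derive1E; have [_ ->] := dF x.
Qed.

Lemma zetaX (n : nat) (t : R) : zeta t ^+ n = zeta (n%:R * t).
Proof.
elim: n => [|n IH].
  by rewrite expr0 mul0r /zeta cos0 sin0.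
rewrite exprS IH /zeta -[in RHS]addn1 natrD mulrDl mul1r cosD sinD.
by apply: complex_ext => /=; ring.
Qed.

(** De Moivre's formula gives explicit primitives of the real and imaginary
    parts, which are periodic. *)
Lemma mean_monoS (n : nat) : mean (mono n.+1%:Z) = 0.
Proof.
pose N : R := n.+1%:R; have N0 : N != 0 by rewrite pnatr_eq0.
have zN t : mono n.+1%:Z t = cos (N * t) +i* sin (N * t).
  by rewrite /mono -[_ ^ _]/(_ ^+ _) zetaX.
have Nper (k : nat) : sin (k%:R * (2 * pi)) = 0 :> R /\ cos (k%:R * (2 * pi)) =
  1 :> R.
  rewrite (mulr_natl pi 2).
  elim: k => [|k [IHs IHc]]; first by rewrite mul0r sin0 cos0.
  rewrite -addn1 natrD mulrDl mul1r.
  by rewrite sinD2pi cosD2pi.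
have [s0 c1] := Nper n.+1.
have dN (x : R) : is_derive x 1 (fun t => N * t) N.
  by apply: is_derive_eq; rewrite /GRing.scale /= mulr1.
have dc (k : R) F x dF : is_derive (N * x) 1 F dF ->
    is_derive x 1 (fun t => k * F (N * t)) (k * (dF * N)).
  by move=> dF'; exact: (is_deriveZ k (is_derive1_comp dF' (dN x))).
have ds (x : R) : is_derive x 1 (fun t : R => N^-1 * sin (N * t)) (cos (N * x)).
  have -> : cos (N * x) = N^-1 * (cos (N * x) * N) by field.
  exact: (dc _ _ _ _ (is_derive_sin _)).
have dcos (x : R) : is_derive x 1 (fun t : R => - N^-1 * cos (N * t)) (sin (N *
  x)).
  have -> : sin (N * x) = - N^-1 * (- sin (N * x) * N) by field.
  exact: (dc _ _ _ _ (is_derive_cos _)).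
have cc : continuous (fun t : R => cos (N * t)).
  by move=> x; apply: continuous_comp;
    [exact: mulrl_continuous|exact: continuous_cos].
have cs : continuous (fun t : R => sin (N * t)).
  by move=> x; apply: continuous_comp;
    [exact: mulrl_continuous|exact: continuous_sin].
rewrite (funext zN); apply: complex_ext => /=.
  by rewrite (integral_circle_FTC ds cc) /= s0 !mulr0 sin0 !mulr0 subrr mulr0.
by rewrite (integral_circle_FTC dcos cs) /= c1 !mulr0 cos0 subrr mulr0.
Qed.

Lemma mean_mono (n : int) : n != 0 -> mean (mono n) = 0.
Proof.
case: n => [[|n]|n] // _; first exact: mean_monoS.
rewrite NegzE -monoJ meanJ ?mean_monoS ?rmorph0//.
have -> : mono n.+1 = mono n.+1 \* conjf (mono 0).
  by rewrite monoJ monoD oppr0 addr0.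
by apply: L1_dot; exact: L2_mono.
Qed.

Lemma fourier_mono (n m : int) : fourier (mono n) m = (n == m)%:R.
Proof.
rewrite /fourier dotpE monoJ monoD; have [->|nm] := eqVneq n m.
  by rewrite subrr mono0 mean_cst.
by rewrite mean_mono// subr_eq0.
Qed.

(** The zero function is only obtained as [0 * z^n], so [span P] is a subspace
    provided that [P] holds somewhere. *)
Inductive span (P : int -> Prop) : set (R -> R[i]) :=
| span_mono c n : P n -> span P (cst c \* mono n)
| spanD f g : span P f -> span P g -> span P (f \+ g).

Lemma span_Linf P f : span P f -> Linf f.
Proof.
elim=> [c n _|g h _ ? _ ?]; last exact: LinfD.
by apply: LinfM; [exact: Linf_cst|exact: Linf_mono].
Qed.

Lemma span_L2 P f : span P f -> L2 f.
Proof. by move=> /span_Linf/Linf_L2. Qed.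

Lemma spanZ P c f : span P f -> span P (cst c \* f).
Proof.
elim=> [d n Pn|g h _ IHg _ IHh].
  rewrite (_ : _ \* _ = cst (c * d) \* mono n); first exact: span_mono.
  by apply/funext => t /=; rewrite mulrA.
rewrite (_ : _ \* _ = (cst c \* g) \+ (cst c \* h)); first exact: spanD.
by apply/funext => t /=; rewrite mulrDr.
Qed.

Lemma span_mulmono (P Q : int -> Prop) m f : (forall n, P n -> Q (m + n)) ->
  span P f -> span Q (mono m \* f).
Proof.
move=> PQ; elim=> [d n Pn|g h _ IHg _ IHh].
  rewrite (_ : _ \* _ = cst d \* mono (m + n)); first exact/span_mono/PQ.
  by rewrite -monoD; apply/funext => t /=; ring.
rewrite (_ : _ \* _ = (mono m \* g) \+ (mono m \* h)); first exact: spanD.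
by apply/funext => t /=; rewrite mulrDr.
Qed.

Definition trig : set (R -> R[i]) := span (fun=> True).

Lemma trig_cst c : trig (cst c).
Proof. by rewrite cst_mono0; exact: span_mono. Qed.

Lemma trigM f g : trig f -> trig g -> trig (f \* g).
Proof.
move=> tf tg; elim: tf => [d n _|p q _ IHp _ IHq].
  rewrite (_ : _ \* _ = cst d \* (mono n \* g)); last first.
    by apply/funext => t /=; rewrite mulrA.
  by apply: spanZ; apply: span_mulmono tg.
rewrite (_ : _ \* _ = (p \* g) \+ (q \* g)); first exact: spanD.
by apply/funext => t /=; rewrite mulrDl.
Qed.

End trigonometric_functions.

(** * Approximation of indicators of half-lines *)

Section trigonometric_density.
Variable R : realType.
Implicit Types (f g h u v : R -> R[i]) (c z w : R[i]) (A B : set R).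
Local Notation mu := (@lebesgue_measure R).
Local Notation T := (@circle R).
Local Notation dense := (adherent (@trig R)).

Let trigD f g : trig f -> trig g -> trig (f \+ g). Proof. exact: spanD. Qed.
Let trigZ c f : trig f -> trig (cst c \* f). Proof. exact: spanZ. Qed.
Let trig_L2 f : trig f -> L2 f. Proof. exact: span_L2. Qed.

Lemma dense_lim f (g_ : nat -> R -> R[i]) : L2 f -> (forall n, L2 (g_ n)) ->
  (forall n, dense (g_ n)) -> N2 (f \- g_ n) @[n --> \oo] --> (0 : R) ->
    dense f.
Proof.
move=> f2 g2 gd fg; apply: adherent_adherent => // e e0.
have /cvgrPdist_lt /(_ e e0) [n _ /(_ n (leqnn n))] := fg.
rewrite /= sub0r normrN ger0_norm ?N2_ge0// => fgn.
by exists (g_ n).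
Qed.

Definition cindic A : R -> R[i] := fun t => (\1_A t)%:C.

Lemma Linf_real (b : R -> R) (M : R) : measurable_fun T b ->
  (forall t, `|b t| <= M) -> Linf (fun t => (b t)%:C).
Proof.
move=> mb bM; split; first by split => //=; exact: measurable_cst.
by exists M; apply: ae_forall => t _; rewrite normc_real.
Qed.

Lemma cindic_L2 A : measurable A -> L2 (cindic A).
Proof.
move=> mA; apply/Linf_L2/(@Linf_real _ 1); first exact: measurable_indic.
by move=> t; rewrite indicE ger0_norm// lern1; case: (_ \in _).
Qed.

(** The polynomials of Brosowski and Deutsch's proof of the Stone-Weierstrass
    theorem: on [[0, 1]] they tend to 1 below [1 / 2] and to 0 above. *)
Definition soft_step (n : nat) (y : R) : R := (1 - y ^+ n) ^+ (2 ^ n).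

Lemma soft_step01 (n : nat) (y : R) : 0 <= y <= 1 -> 0 <= soft_step n y <= 1.
Proof.
move=> /andP[y0 y1]; have yn := exprn_ge0 n y0; have yn1 := exprn_ile1 n y0 y1.
by rewrite exprn_ge0 ?exprn_ile1// ?subr_ge0// lerBlDr lerDl.
Qed.

Lemma bernoulli_lower (m : nat) (x : R) : 0 <= x <= 1 ->
  1 - m%:R * x <= (1 - x) ^+ m.
Proof.
move=> /andP[x0 x1]; elim: m => [|m IH]; first by rewrite mul0r subr0.
have m0 : 0 <= m%:R * x ^+ 2 :> R by rewrite mulr_ge0 ?sqr_ge0.
rewrite exprS -natr1; have := ler_wpM2l _ IH; move/(_ (1 - x)).
rewrite subr_ge0 => /(_ x1); apply: le_trans.
by rewrite expr2 in m0; lra.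
Qed.

(** Bernoulli's inequality for [1 + x], multiplied by [(1 - x) ^+ m]: the larger
    side becomes [(1 - x ^+ 2) ^+ m], at most 1. *)
Lemma bernoulli_upper (m : nat) (x : R) : 0 <= x <= 1 ->
  (1 - x) ^+ m * (1 + m%:R * x) <= 1.
Proof.
move=> /andP[x0 x1]; elim: m => [|m IH]; first by rewrite mul0r addr0 mulr1.
rewrite exprSr; apply: le_trans IH; rewrite -mulrA ler_wpM2l//.
  by rewrite exprn_ge0// subr_ge0.
have m0 : 0 <= m%:R * x ^+ 2 :> R by rewrite mulr_ge0 ?sqr_ge0.
have := sqr_ge0 x; rewrite -natr1; rewrite !expr2 in m0 *; lra.
Qed.

(** Both cases follow from Bernoulli's inequality for [y ^+ n], because
    [2 ^ n * y ^+ n = (2 * y) ^+ n] tends to 0 or to infinity. *)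
Lemma soft_step_cvg (y : R) : 0 <= y <= 1 -> y != 2^-1 ->
  soft_step n y @[n --> \oo] --> ((y < 2^-1)%R%:R : R).
Proof.
move=> y01; have /andP[y0 y1] := y01; have y2 : 0 <= 2 * y by rewrite mulr_ge0.
have yn01 n : 0 <= y ^+ n <= 1 by rewrite exprn_ge0 ?exprn_ile1.
have e2 n : (2 ^ n)%:R * y ^+ n = (2 * y) ^+ n by rewrite natrX -exprMn.
rewrite neq_lt => /orP[yh|yh].
  rewrite yh; apply: (@squeeze_cvgr _ _ _ _ (fun n => 1 - (2 * y) ^+ n) (fun=>
    1)).
  - apply: nearW => n; have /andP[_ ->] := soft_step01 n y01.
    by rewrite andbT -e2 bernoulli_lower.
  - rewrite -[X in _ --> X]subr0; apply: cvgB; first exact: cvg_cst.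
    apply: cvg_expr; rewrite ger0_norm//; lra.
  - exact: cvg_cst.
rewrite ltNge (ltW yh) /=.
have y20 : 0 < 2 * y by lra.
apply: (@squeeze_cvgr _ _ _ _ (fun=> 0) (fun n => ((2 * y)^-1) ^+ n)).
- apply: nearW => n; have /andP[-> _] := soft_step01 n y01.
  rewrite /= exprVn -[leRHS]mul1r ler_pdivlMr ?exprn_gt0//.
  apply: le_trans (bernoulli_upper (2 ^ n) (yn01 n)).
  rewrite e2 ler_wpM2l//; first by have /andP[] := soft_step01 n y01.
  by rewrite lerDr.
- exact: cvg_cst.
apply: cvg_expr; rewrite ger0_norm ?invr_ge0//.
by rewrite invf_lt1//; lra.
Qed.

(** A trigonometric polynomial that crosses the threshold [1 / 2] of
    [soft_step] at [t = a] and at the endpoint [t = 0] of the circle only. *)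
Definition ramp (a t : R) : R :=
  2^-1 - 2^-1 * (sin ((t - a) / 2) * sin (t / 2)).

Lemma ramp01 (a t : R) : 0 <= ramp a t <= 1.
Proof.
rewrite /ramp; set s := sin _ * sin _.
have : `|s| <= 1.
  by rewrite normrM mulr_ile1// ler_norml sin_geN1 sin_le1.
by rewrite ler_norml => /andP[s1 s2]; apply/andP; split; lra.
Qed.

(** The product of sines is half of [cos (a / 2) - cos (t - a / 2)]. *)
Lemma ramp_trig (a : R) : trig (fun t => (ramp a t)%:C).
Proof.
pose k := (zeta (a / 2))^*.
have -> : (fun t => (ramp a t)%:C) =
    cst (2^-1 - 4^-1 * cos (a / 2))%:C \+
    ((cst (8^-1%:C * k) \* mono 1) \+ (cst (8^-1%:C * k^*) \* mono (-1))).
  apply/funext => t; rewrite /= -[mono (-1)]monoJ !mono1 /conjf /k conjCK /ramp.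
  have -> : (t - a) / 2 = t / 2 - a / 2 by ring.
  have -> : zeta t = zeta (t / 2 + t / 2) by congr zeta; field.
  rewrite sinB /zeta cosD sinD.
  have := cos2Dsin2 (t / 2).
  move: (cos (t / 2)) (sin (t / 2)) (cos (a / 2)) (sin (a / 2)) => x y p q xy.
  apply: complex_ext; rewrite /= ?mul0r ?subr0 ?addr0 ?add0r; last by field.
  have -> : x * x = 1 - y * y by rewrite -xy; ring.
  by field.
by apply: trigD; [exact: trig_cst|apply: trigD; exact: span_mono].
Qed.

Lemma trigX f n : trig f -> trig (fun t => f t ^+ n).
Proof.
move=> tf; elim: n => [|n IH]; first exact: trig_cst.
rewrite (_ : (fun t => _) = f \* (fun t => f t ^+ n)); first exact: trigM.
by apply/funext => t; rewrite exprS.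
Qed.

Lemma soft_step_trig (b : R -> R) n : trig (fun t => (b t)%:C) ->
  trig (fun t => (soft_step n (b t))%:C).
Proof.
move=> tb; pose g : R -> R[i] := cst 1 \+ (cst (-1) \* (fun t => (b t)%:C ^+
  n)).
rewrite (_ : (fun t => _) = (fun t => g t ^+ (2 ^ n))).
  by apply: trigX; apply: trigD; [exact: trig_cst|apply: trigZ; exact: trigX].
by apply/funext => t; rewrite /g /soft_step /= rmorphXn rmorphB rmorphXn
  rmorph1 mulN1r.
Qed.

Lemma ae_neq (a : R) : {ae mu, forall t, t != a}.
Proof.
exists [set a]; split; [exact: measurable_set1|exact: lebesgue_measure_set1|].
by move=> t /= /negP; rewrite negbK => /eqP.
Qed.

(** Here [t / 2] and [(t - a) / 2] lie in [[0, pi]] and [[- pi, pi]], where the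
    sign of the sine is that of its argument. *)
Lemma ramp_lt (a t : R) : 0 <= a <= 2 * pi -> 0 < t < 2 * pi -> t != a ->
  ramp a t != 2^-1 /\ (ramp a t < 2^-1) = (a < t).
Proof.
move=> /andP[a0 a2] /andP[t0 t2] ta.
have s2 : 0 < sin (t / 2) by apply: sin_gt0_pi; lra.
rewrite /ramp; case: (ltgtP a t) ta => // [at_|ta] _.
- have s1 : 0 < sin ((t - a) / 2) by apply: sin_gt0_pi; lra.
  have := mulr_gt0 s1 s2; set p := _ * _ => p0.
  split; first by rewrite lt_eqF//; lra.
  by apply/idP; lra.
- have s1 : sin ((t - a) / 2) < 0.
    rewrite -oppr_gt0 -sinN; apply: sin_gt0_pi; lra.
  have := s1; rewrite -(pmulr_llt0 _ s2); set p := _ * _ => p0.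
  split; first by rewrite gt_eqF//; lra.
  by apply/negbTE; rewrite -leNgt; lra.
Qed.

Lemma normc_realB (a b : R) : normc (a%:C - b%:C) = `|a - b|.
Proof. by rewrite -rmorphB normc_real. Qed.

(** The approximants [soft_step n (ramp a t)] take their values in [[0, 1]] and
    converge to the indicator for [t] distinct from [0] and [a]. *)
Lemma dense_ray (a : R) : 0 <= a <= 2 * pi -> dense (cindic `]a, +oo[).
Proof.
move=> a02.
apply: (@dense_lim _ (fun n t => (soft_step n (ramp a t))%:C)).
- exact: cindic_L2.
- by move=> n; apply/trig_L2/soft_step_trig/ramp_trig.
- by move=> n; apply/adherent_mem/soft_step_trig/ramp_trig.
apply: (@N2_cvg0 _ _ (fun=> 1)).
- move=> n; apply: L2B; first exact: cindic_L2.
  by apply/trig_L2/soft_step_trig/ramp_trig.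
- exact: integrable_cst_circle.
- move=> n; apply: ae_forall => t _.
  rewrite [normc _]normc_realB real_normK ?num_real// indicE.
  have /andP[b0 b1] := soft_step01 n (ramp01 a t).
  by case: (_ \in _) => /=; nra.
apply: ae_imply2 (ae_neq 0) (ae_neq a) => t t0 ta.
rewrite /circle /= in_itv /= => /andP[t0' t2].
have tT : 0 < t < 2 * pi by rewrite lt_neqAle eq_sym t0 t0'.
have [rn rE] := ramp_lt a02 tT ta.
have := soft_step_cvg (ramp01 a t) rn; rewrite rE => /cvgrPdist_lt h.
apply/cvgrPdist_lt => e e0; have e1 : 0 < Num.min e 1 by rewrite lt_min e0
  ltr01.
have [n _ nh] := h _ e1; exists n => // m /nh.
rewrite lt_min => /andP[xe x1].
suff: (`|0 - normc ((\1_`]a, +oo[ t)%:C - (soft_step m (ramp a t))%:C) ^+ 2| <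
  e) by [].
rewrite normc_realB sub0r normrN normrX normr_id.
rewrite indicE mem_setE in_itv /= andbT.
move: xe x1; set x := _ - _ => xe x1; have := normr_ge0 x; nra.
Qed.

End trigonometric_density.

(** * Density of the trigonometric polynomials *)

Section trigonometric_density_L2.
Import HBNNSimple.
Variable R : realType.
Implicit Types (f g h u v : R -> R[i]) (c z w : R[i]) (A B : set R).
Local Notation mu := (@lebesgue_measure R).
Local Notation T := (@circle R).
Local Notation dense := (adherent (@trig R)).

Let denseD f g : L2 f -> L2 g -> dense f -> dense g -> dense (f \+ g).
Proof. by move=> f2 g2; apply: adherentD => //;
  [exact: span_L2|exact: spanD]. Qed.

Let denseZ c f : L2 f -> dense f -> dense (cst c \* f).
Proof. by move=> f2; apply: adherentZ => //; [exact: span_L2|exact: spanZ]. Qed.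

Lemma dense_eq_on_circle f g : (forall t, T t -> f t = g t) -> L2 f ->
  L2 g -> dense f -> dense g.
Proof.
move=> fg f2 g2 fd; apply: (@dense_lim _ _ (fun=> f)) => //.
rewrite N2_eq0; first exact: cvg_cst.
by move=> t Tt /=; rewrite fg// subrr.
Qed.

(** A half-line that starts outside [[0, 2 * pi]] contains the whole circle or
    none of it. *)
Lemma dense_ray_all (a : R) : dense (cindic `]a, +oo[).
Proof.
have mr (b : R) : L2 (cindic `]b, +oo[) by apply: cindic_L2.
have [a0|a0] := ltP a 0.
  apply: (@dense_eq_on_circle (cst 1)) => //.
  - move=> t; rewrite /circle /= in_itv /= => /andP[t0 _].
    by rewrite /cindic indicE mem_setE in_itv /= (lt_le_trans a0 t0).
  - exact/Linf_L2/Linf_cst.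
  - exact/adherent_mem/trig_cst.
have [a2|a2] := leP a (2 * pi); first by apply: dense_ray; rewrite a0.
apply: (@dense_eq_on_circle (cst 0)) => //.
- move=> t; rewrite /circle /= in_itv /= => /andP[_ t2].
  by rewrite /cindic indicE mem_setE in_itv /= andbT ltNge (ltW (lt_trans t2
    a2)).
- exact/Linf_L2/Linf_cst.
- exact/adherent_mem/trig_cst.
Qed.

Lemma cindicT : cindic setT = cst 1 :> (R -> R[i]).
Proof. by apply/funext => t; rewrite /cindic indicT. Qed.

Lemma cindic0 : cindic set0 = cst 0 :> (R -> R[i]).
Proof. by apply/funext => t; rewrite /cindic indic0. Qed.

Lemma cindicC A : cindic (~` A) = cst 1 \+ (cst (-1) \* cindic A).
Proof.
apply/funext => t; rewrite /cindic /= indicC indicE mulN1r.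
by apply: complex_ext; case: (t \in A) => /=;
  rewrite ?oppr0 ?subrr ?addr0 ?subr0.
Qed.

Lemma dense_cindicU A B : measurable A -> measurable B -> A `&` B = set0 ->
  dense (cindic A) -> dense (cindic B) -> dense (cindic (A `|` B)).
Proof.
move=> mA mB AB dA dB.
have -> : cindic (A `|` B) = cindic A \+ cindic B.
  apply/funext => t; rewrite /cindic /= -rmorphD; congr (_%:C).
  rewrite !indicE in_setU.
  have : ~~ ((t \in A) && (t \in B)) by rewrite -in_setI AB in_set0.
  by case: (t \in A); case: (t \in B) => //= _; rewrite ?addr0 ?add0r.
by apply: denseD => //; exact: cindic_L2.
Qed.

(** Half-lines are stable under intersection and generate the Borel sets, and
    the sets whose indicator can be approximated form a Dynkin class. *)
Lemma dense_cindic A : measurable A -> dense (cindic A).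
Proof.
move=> mA.
have GE : (@measurable _ (measurableTypeR R)) = <<s @RGenOInfty.G R >>.
  exact: RGenOInfty.measurableE.
apply: (@dynkin_induction _ (measurableTypeR R) (@RGenOInfty.G R)
  (fun A => dense (cindic A))) => //.
- move=> _ _ [a ->] [b ->]; exists (Num.max a b).
  by apply/seteqP; split => t /=; rewrite !in_itv /= !andbT gt_max => /andP.
- rewrite cindicT; exact/adherent_mem/trig_cst.
- by move=> _ [a ->]; exact: dense_ray_all.
- move=> S mS dS.
  rewrite cindicC.
  apply: denseD => //.
  + exact/Linf_L2/Linf_cst.
  + by apply: L2Z; exact: cindic_L2.
  + exact/adherent_mem/trig_cst.
  + by apply: denseZ => //; exact: cindic_L2.
- move=> F mF tF dF.
  pose U n := \big[setU/set0]_(k < n) F k.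
  have mU n : measurable (U n) by apply: bigsetU_measurable.
  have mUF : measurable (\bigcup_k F k) by apply: bigcup_measurable.
  have dU n : dense (cindic (U n)).
    elim: n => [|n IH]; rewrite /U.
      by rewrite big_ord0 cindic0; exact/adherent_mem/trig_cst.
    rewrite big_ord_recr /=; apply: (dense_cindicU (mU n) (mF n) _ IH (dF n)).
    rewrite setIC /U -bigcup_mkord; apply/seteqP;
      split => // t [Fn [k /= kn Fk]].
    have := tF k n I I (ex_intro _ t (conj Fk Fn)) => kn'.
    by move: kn; rewrite kn' ltnn.
  apply: (@dense_lim _ _ (fun n => cindic (U n))) => //.
  + exact: cindic_L2.
  + by move=> n; exact: (cindic_L2 (mU n)).
  apply: (@N2_cvg0 _ _ (fun=> 1)).
  + by move=> n; apply: L2B; [exact: cindic_L2|exact: (cindic_L2 (mU n))].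
  + exact: integrable_cst_circle.
  + move=> n; apply: ae_forall => t _; rewrite [normc _]normc_realB !indicE.
    by case: (_ \in _); case: (_ \in _) => /=;
      rewrite ?subrr ?subr0 ?sub0r ?normrN ?normr1 ?normr0 ?expr1n ?expr0n.
  apply: ae_forall => t _.
  have [[k _ Fkt]|nF] := pselect ((\bigcup_k F k) t); last first.
    apply: cvg_near_cst; apply: nearW => n.
    rewrite [normc _]normc_realB !indicE !memNset ?subrr ?normr0 ?expr0n//.
    by rewrite /U -bigcup_mkord => -[k _ Fk]; apply: nF; exists k.
  apply: cvg_near_cst; exists k.+1 => // n kn.
  rewrite [normc _]normc_realB !indicE !mem_set ?subrr ?normr0 ?expr0n//.
    by rewrite /U -bigcup_mkord; exists k.
  by exists k.
- by rewrite -GE.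
Qed.

Lemma dense_sum (I : Type) (s : seq I) (F : I -> R -> R[i]) :
  (forall i, L2 (F i)) -> (forall i, dense (F i)) ->
  L2 (fun t => \sum_(i <- s) F i t) /\ dense (fun t => \sum_(i <- s) F i t).
Proof.
move=> F2 dF; elim: s => [|i s [IH2 IHd]].
  rewrite (_ : (fun t => _) = cst 0); last by apply/funext => t;
    rewrite big_nil.
  by split; [exact/Linf_L2/Linf_cst|exact/adherent_mem/trig_cst].
rewrite (_ : (fun t => _) = F i \+ (fun t => \sum_(i <- s) F i t)); last first.
  by apply/funext => t; rewrite big_cons.
by split; [exact: L2D|exact: denseD].
Qed.

Lemma dense_nnsfun (g : {nnsfun R >-> R}) :
  L2 (fun t => (g t)%:C) /\ dense (fun t => (g t)%:C).
Proof.
pose F (y : R) : R -> R[i] := cst y%:C \* cindic (g @^-1` [set y]).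
have mg (y : R) : measurable (g @^-1` [set y]) by exact: measurable_sfunP.
have -> : (fun t => (g t)%:C) = (fun t => \sum_(y <- finmap.enum_fset (fset_set
  (range g))) F y t).
  apply/funext => t; rewrite fimfunE fsbig_finite//= rmorph_sum.
  by apply: eq_bigr => i _; rewrite /F /cindic /= rmorphM.
apply: dense_sum => y; first by apply: L2Z; exact: (cindic_L2 (mg y)).
by apply: denseZ; [exact: (cindic_L2 (mg y))|exact: (dense_cindic (mg y))].
Qed.

(** The increasing simple approximations of [b] are dominated by [b]. *)
Lemma dense_nonneg (b : R -> R) : (forall t, 0 <= b t) ->
  L2 (fun t => (b t)%:C) -> dense (fun t => (b t)%:C).
Proof.
move=> b0 b2; have [[mb _] ib] := b2.
have mT : measurable T by exact: measurable_circle.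
have mEb : measurable_fun T (EFin \o b) by exact/measurable_EFinP.
pose g n := nnsfun_approx mT mEb n.
have bnd t : T t -> forall n, 0 <= g n t <= b t.
  move=> Tt n; rewrite fun_ge0 /= /g nnsfun_approxE -lee_fin.
  by apply: le_approx => // x _; rewrite lee_fin.
apply: (@dense_lim _ _ (fun n t => (g n t)%:C)) => //.
- by move=> n; have [] := dense_nnsfun (g n).
- by move=> n; have [] := dense_nnsfun (g n).
apply: (@N2_cvg0 _ _ (fun t => normc (b t)%:C ^+ 2)) => //.
- by move=> n; apply: L2B => //; have [] := dense_nnsfun (g n).
- move=> n; apply: ae_forall => t Tt; rewrite [normc _]normc_realB normc_real.
  have /andP[g0 gb] := bnd t Tt n.
  by rewrite ler_pXn2r ?nnegrE// !ger0_norm ?subr_ge0// lerBlDr lerDl.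
apply: ae_forall => t Tt.
have := @cvg_nnsfun_approx _ _ _ _ mT _ mEb (fun x _ => b0 x) t Tt.
move=> /fine_cvg gt.
rewrite (_ : (fun n => _) = (fun n => (b t - g n t) * (b t - g n t)));
  last first.
  by apply/funext => n; rewrite [normc _]normc_realB real_normK ?num_real//
    expr2.
have d0 : b t - g n t @[n --> \oo] --> (0 : R).
  by rewrite -(subrr (b t)); apply: cvgB => //; exact: cvg_cst.
by rewrite -[X in _ --> X](mulr0 0); exact: cvgM.
Qed.

Lemma L2_le f (b : R -> R) : measurable_fun T b -> L2 f ->
  (forall t, T t -> `|b t| <= normc (f t)) -> L2 (fun t => (b t)%:C).
Proof.
move=> mb [mf fi] bf; split; first by split => //=; exact: measurable_cst.
apply: le_integrable_real fi.
  by apply: mcfun_sqr; split => //=; exact: measurable_cst.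
move=> t Tt; rewrite normc_real ger0_norm ?sqr_ge0// ler_pXn2r ?nnegrE
  ?normc_ge0//.
exact: bf.
Qed.

Lemma dense_real (b : R -> R) :
  L2 (fun t => (b t)%:C) -> dense (fun t => (b t)%:C).
Proof.
move=> b2; have [[mb _] ib] := b2.
have p2 : L2 (fun t => (b^\+ t)%:C).
  apply: L2_le b2 _; first exact: measurable_funrpos.
  move=> t _; rewrite normc_real /funrpos; case: (leP (b t) 0) => h.
    by rewrite normr0.
  by [].
have n2 : L2 (fun t => (b^\- t)%:C).
  apply: L2_le b2 _; first exact: measurable_funrneg.
  move=> t _; rewrite normc_real /funrneg; case: (leP (- b t) 0) => h.
    by rewrite normr0.
  by rewrite normrN.
have -> : (fun t => (b t)%:C) =
    (fun t => (b^\+ t)%:C) \+ (cst (-1) \* (fun t => (b^\- t)%:C)).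
  apply/funext => t /=; rewrite mulN1r -rmorphB.
  congr (_%:C); rewrite /funrpos /funrneg.
  by case: (leP (b t) 0) => h1; case: (leP (- b t) 0) => h2; lra.
apply: denseD => //; first exact: L2Z.
  by apply: dense_nonneg => // t; rewrite /funrpos le_max lexx orbT.
apply: denseZ => //.
by apply: dense_nonneg => // t; rewrite /funrneg le_max lexx orbT.
Qed.

Lemma trig_dense f : L2 f -> dense f.
Proof.
move=> f2; have [[mr mi] fi] := f2.
have r2 : L2 (fun t => (complex.Re (f t))%:C).
  by apply: L2_le f2 _ => // t _; exact: Re_le_normc.
have i2 : L2 (fun t => (complex.Im (f t))%:C).
  by apply: L2_le f2 _ => // t _; exact: Im_le_normc.
have -> : f = (fun t => (complex.Re (f t))%:C) \+
    (cst 'i%C \* (fun t => (complex.Im (f t))%:C)).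
  by apply/funext => t /=; rewrite {1}[f t]complexE.
apply: denseD => //; [exact: L2Z|exact: dense_real|].
by apply: denseZ => //; exact: dense_real.
Qed.

End trigonometric_density_L2.

(** * The Hardy space *)

Section Hardy_space.
Variable R : realType.
Implicit Types (f g h u v p q : R -> R[i]) (c z w : R[i]).
Local Notation mu := (@lebesgue_measure R).
Local Notation T := (@circle R).

Local Hint Resolve Linf_cst Linf_mono L2_mono L2_cst : core.

(** As [0 ^+ 0 = 1], the partial sums are constant from the first one on. *)
Lemma lim_series_at0 (K : numFieldType) (a : nat -> K) :
  limn (series (fun n => a n * 0 ^+ n : K^o)) = a 0.
Proof.
apply: cvg_lim; first exact: (@norm_hausdorff _ K^o).
apply: cvg_near_cst; exists 1%N => // -[|n] //= _.
rewrite /series /= big_nat_recl// expr0 mulr1 big1 ?addr0// => k _.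
by rewrite expr0n mulr0.
Qed.

Lemma ev0E f : ev0 f = fourier f 0.
Proof. exact: (@lim_series_at0 R[i] (fun n => fourier f n%:Z)). Qed.

Lemma fourierE f n : fourier f n = dotp f (mono n). Proof. by []. Qed.

Lemma H2_L2 f : H2 f -> L2 f. Proof. by case. Qed.
Local Hint Extern 0 (L2 _) => (apply: H2_L2; assumption) : core.

Lemma H2D f g : H2 f -> H2 g -> H2 (f \+ g).
Proof.
move=> [f2 fn] [g2 gn]; split; first exact: L2D.
by move=> n n0; rewrite fourierE dotpDl //; rewrite -!fourierE fn// gn// addr0.
Qed.

Lemma H2Z c f : H2 f -> H2 (cst c \* f).
Proof.
move=> [f2 fn]; split; first exact: L2Z.
by move=> n n0; rewrite fourierE dotpZl //; rewrite -fourierE fn// mulr0.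
Qed.

Lemma H2B f g : H2 f -> H2 g -> H2 (f \- g).
Proof. by move=> fH gH; rewrite fun_subE; apply: H2D => //; exact: H2Z. Qed.

Lemma H2_mono (n : nat) : H2 (@mono R n%:Z).
Proof.
split; first exact: L2_mono.
by move=> m m0; rewrite fourier_mono; case: eqP m0 => // <-.
Qed.

Lemma H2_cst c : H2 (cst c).
Proof. by rewrite cst_mono0; apply/H2Z/H2_mono. Qed.

Lemma dotp_monoM m f n : dotp (mono m \* f) (mono n) = fourier f (n - m).
Proof. by rewrite dotp_mull monoJ monoD addrC. Qed.

Lemma dotp_monoMM m f g : dotp (mono m \* f) (mono m \* g) = dotp f g.
Proof.
rewrite dotp_mull monoJ; congr dotp; apply/funext => t /=.
by rewrite mulrA -[X in X * _]/((mono (- m) \* mono m) t) monoD addNr mono0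
  mul1r.
Qed.

Lemma H2_zeta f : H2 f -> H2 (mono 1 \* f).
Proof.
move=> [f2 fn]; split; first by apply: L2M.
by move=> n n0; rewrite fourierE dotp_monoM fn//; lia.
Qed.

Lemma bshiftE f : bshift f = mono (-1) \* (f \- cst (ev0 f)).
Proof.
by apply/funext => t; rewrite /bshift /= mulrC -monoJ mono1 /conjf zetaJ.
Qed.

(** The splitting [f = f(0) + z S^* f], a pointwise identity. *)
Lemma bshiftK f : f = cst (ev0 f) \+ (mono 1 \* bshift f).
Proof.
apply/funext => t; rewrite /bshift /= mono1 mulrC divfK ?zeta_neq0//.
by rewrite addrC subrK.
Qed.

(** Subtracting [ev0 f] removes the only coefficient that division by [z] moves
    to a negative index. *)
Lemma H2_bshift f : H2 f -> H2 (bshift f).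
Proof.
move=> fH; have [f2 fn] := fH; rewrite bshiftE; split.
  by apply: L2M => //; exact: L2B.
move=> n n0; rewrite fourierE dotp_monoM opprK.
have [n1|n1] := eqVneq n (-1); last first.
  by have [_] := H2B fH (H2_cst (ev0 f)); apply; lia.
rewrite n1 addNr fourierE dotpBl //.
rewrite -fourierE -ev0E mono0 dotpE.
have -> : cst (ev0 f) \* conjf (cst 1) = cst (ev0 f) :> (R -> R[i]).
  by apply/funext => t; rewrite /conjf /= rmorph1 mulr1.
by rewrite mean_cst subrr.
Qed.

Lemma HinfE f : Hinf f <-> H2 f /\ Linf f.
Proof.
split=> [[fH fM]|[fH [_ fM]]]; last by split.
by split => //; split => //; case: fH => -[].
Qed.

Lemma inner_H2 (theta : R -> R[i]) : inner_function theta -> H2 theta.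
Proof. by case=> /HinfE[]. Qed.

Lemma inner_Linf (theta : R -> R[i]) : inner_function theta -> Linf theta.
Proof. by case=> /HinfE[]. Qed.

Definition analytic_poly : set (R -> R[i]) := span (fun n : int => 0 <= n).

Lemma analytic_poly_H2 f : analytic_poly f -> H2 f.
Proof.
elim=> [c [n|n] // _|g h _ ? _ ?]; last exact: H2D.
exact/H2Z/H2_mono.
Qed.

Lemma span_orth (P : int -> Prop) p v : L2 v ->
  (forall n, P n -> dotp (mono n) v = 0) -> span P p -> dotp p v = 0.
Proof.
move=> v2 nv; elim=> [c n Pn|g h sg IHg sh IHh].
  by rewrite dotpZl ?nv ?mulr0//; exact: L2_mono.
by rewrite dotpDl ?IHg ?IHh ?addr0//; [exact: span_L2 sg|exact: span_L2 sh].
Qed.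

Lemma trig_split p : trig p -> exists q r,
  [/\ analytic_poly q, span (fun n : int => n < 0) r & p = q \+ r].
Proof.
have zero (P : int -> Prop) n : P n ->
  span P (cst 0 \* @mono R n) by exact: span_mono.
have a0 : analytic_poly (cst 0 \* @mono R 0) by exact: zero.
have m0 : span (fun n : int => n < 0) (cst 0 \* @mono R (-1)) by exact: zero.
elim=> [c n _|f g _ [q1 [r1 [q1a r1n ->]]] _ [q2 [r2 [q2a r2n ->]]]].
  have [n0|n0] := leP 0 n.
    exists (cst c \* mono n), (cst 0 \* mono (-1)); split => //.
      exact: span_mono.
    by apply/funext => t /=; rewrite mul0r addr0.
  exists (cst 0 \* mono 0), (cst c \* mono n); split => //;
    first exact: span_mono.
  by apply/funext => t /=; rewrite mul0r add0r.
exists (q1 \+ q2), (r1 \+ r2); split; [exact: spanD|exact: spanD|].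
by apply/funext => t /=; ring.
Qed.

(** Dropping the negative frequencies of a trigonometric approximation of [f]
    does not increase the distance to [f], since they are orthogonal to [H2]. *)
Lemma analytic_poly_dense f : H2 f -> adherent analytic_poly f.
Proof.
move=> fH e e0; have [f2 fn] := fH.
have [p [/trig_split[q [r [qa rn ->]]] fp]] := trig_dense f2 e0.
exists q; split => //; apply: le_lt_trans fp.
have q2 := span_L2 qa; have r2 := span_L2 rn.
have fq2 : H2 (f \- q) by apply: H2B => //; exact: analytic_poly_H2.
have -> : f \- (q \+ r) = (f \- q) \+ (cst (-1) \* r).
  by apply/funext => t /=; ring.
have fq := H2_L2 fq2.
rewrite (N2D_orth fq (L2Z (-1) r2)) ?lerDl ?N2_ge0//.
rewrite dotpZr// (dotpC r2 fq) (span_orth fq _ rn) ?rmorph0 ?mulr0// => n n0.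
by rewrite (dotpC fq (L2_mono R n)) -fourierE (proj2 fq2 n n0) rmorph0.
Qed.

Lemma H2_orth f v : H2 f -> L2 v ->
  (forall n : nat, dotp (mono n%:Z) v = 0) -> dotp f v = 0.
Proof.
move=> fH v2 nv; apply: (dotp_adherent (H2_L2 fH) v2 (analytic_poly_dense fH))
  => p pa.
split; first exact: span_L2 pa.
by apply: span_orth pa => // -[n|n].
Qed.

(** Evaluation at 0 is multiplicative: the left-hand side is the mean of [f g].
    Both sides are continuous in [f], so it is enough to let [f] be a monomial,
    where they are Fourier coefficients of [g]. *)
Lemma mean_mul_H2 f g : H2 f -> H2 g -> dotp f (conjf g) = ev0 f * ev0 g.
Proof.
move=> fH gH; have [g2 gn] := gH; have f2 := H2_L2 fH.
have c2 : L2 (cst (ev0 g)^* : R -> R[i]) by exact/Linf_L2/Linf_cst.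
have Jg2 := L2J g2.
have f1 : dotp f (cst (ev0 g)^*) = ev0 f * ev0 g.
  by rewrite cst_mono0 dotpZr // conjCK -fourierE -ev0E mulrC.
apply/eqP; rewrite -f1 -subr_eq0 -dotpBr//; apply/eqP/H2_orth => //;
  first exact: L2B.
move=> n; rewrite dotpBr //.
have -> : dotp (mono n%:Z) (conjf g) = fourier g (- n%:Z).
  rewrite fourierE -monoJ !dotpE; congr mean; apply/funext => t.
  by rewrite /conjf /= !conjCK mulrC.
have -> : dotp (mono n%:Z) (cst (ev0 g)^*) = (ev0 g * (n%:Z == 0)%:R).
  by rewrite cst_mono0 dotpZr // conjCK -fourierE fourier_mono.
case: n => [|n]; first by rewrite oppr0 mulr1 ev0E subrr.
by rewrite gn// mulr0 subrr.
Qed.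

Lemma ev0_zeta f : H2 f -> ev0 (mono 1 \* f) = 0.
Proof. by move=> [_ fn]; rewrite ev0E fourierE dotp_monoM fn. Qed.

Lemma ev0_cst c : ev0 (cst c : R -> R[i]) = c.
Proof.
rewrite ev0E fourierE mono0 dotpE -[RHS](mean_cst c); congr mean.
by apply/funext => t; rewrite /conjf /= rmorph1 mulr1.
Qed.

Lemma ev0D f g : L2 f -> L2 g -> ev0 (f \+ g) = ev0 f + ev0 g.
Proof. by move=> f2 g2; rewrite !ev0E fourierE dotpDl . Qed.

Lemma ev0Z c f : L2 f -> ev0 (cst c \* f) = c * ev0 f.
Proof. by move=> f2; rewrite !ev0E fourierE dotpZl . Qed.

Lemma dotp_cst_ev0 g c : H2 g -> dotp (cst c) g = c * (ev0 g)^*.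
Proof.
move=> gH; have g2 := H2_L2 gH.
by rewrite cst_mono0 dotpZl// (dotpC g2 (L2_mono R 0)) -fourierE -ev0E.
Qed.

End Hardy_space.

(** * The model space *)

Section model_space_theory.
Variable R : realType.
Variable theta : R -> R[i].
Hypothesis theta_inner : inner_function theta.
Implicit Types (f g h u v p q F : R -> R[i]) (c z w : R[i]).
Local Notation mu := (@lebesgue_measure R).
Local Notation T := (@circle R).
Local Notation K := (model_space theta).

Local Hint Resolve Linf_cst Linf_mono L2_mono L2_cst : core.
Local Hint Extern 0 (L2 _) => (apply: H2_L2; assumption) : core.

Let theta_H2 : H2 theta.
Proof. exact: inner_H2. Qed.

Let theta_Linf : Linf theta.
Proof. exact: inner_Linf. Qed.

Let theta_L2 : L2 theta.
Proof. exact: H2_L2. Qed.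

Local Hint Resolve theta_H2 theta_Linf theta_L2 : core.

Lemma dotp_theta f g : L2 f -> L2 g ->
  dotp (theta \* f) (theta \* g) = dotp f g.
Proof.
move=> f2 g2; apply: dotp_ae => //; try exact: L2M.
case: theta_inner => _; apply: ae_imply => t /[apply] th1 /=.
by rewrite rmorphM /= mulrACA mulJc th1 expr1n mul1r.
Qed.

Lemma K_H2 f : K f -> H2 f. Proof. by case. Qed.
Lemma K_L2 f : K f -> L2 f. Proof. by case=> /H2_L2. Qed.
Local Hint Extern 0 (H2 _) => (apply: K_H2; assumption) : core.
Local Hint Extern 0 (L2 _) => (apply: K_L2; assumption) : core.

(** A negative Fourier coefficient of [theta g] is the inner product of [g] with
    [conj(theta) z^n], [n < 0], which has no nonnegative frequency. *)
Lemma H2_thetaM g : H2 g -> H2 (theta \* g).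
Proof.
move=> gH; have g2 := H2_L2 gH; split; first exact: L2M.
move=> n n0; rewrite fourierE dotp_mull; apply: H2_orth => // [|m].
  by apply: L2M => //; exact: LinfJ.
have -> : dotp (mono m%:Z) (conjf theta \* mono n) = fourier theta (n - m%:Z).
  rewrite fourierE -(addrC (- m%:Z)) -monoD -monoJ -dotp_mull !dotpE.
  congr mean; apply/funext => t.
  by rewrite /conjf /= !rmorphM /= !conjCK; ring.
by rewrite (proj2 theta_H2)//; lia.
Qed.

Lemma K_subspace c f g : K f -> K g -> K ((cst c \* f) \+ g).
Proof.
move=> [fH fo] [gH go]; split; first by apply: H2D => //; exact: H2Z.
move=> h hH; have h2 : L2 (theta \* h) by apply: L2M => //; exact: H2_L2.
by rewrite dotpDl ?dotpZl ?fo ?go ?mulr0 ?addr0//; exact: L2Z.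
Qed.

Lemma KD f g : K f -> K g -> K (f \+ g).
Proof.
move=> fK gK; have := K_subspace 1 fK gK.
by rewrite (_ : cst 1 \* f = f)//; apply/funext => t /=; rewrite mul1r.
Qed.

Lemma K0 : K (cst 0).
Proof.
split=> [|g gH]; first exact: H2_cst.
have -> : cst 0 = cst 0 \* cst 0 :> (R -> R[i]).
  by apply/funext => t /=; rewrite mul0r.
by rewrite dotpZl ?mul0r//; apply: L2M => //; exact: H2_L2.
Qed.

Lemma KZ c f : K f -> K (cst c \* f).
Proof.
move=> fK; have := K_subspace c fK K0.
by rewrite (_ : _ \+ _ = cst c \* f)//; apply/funext => t /=; rewrite addr0.
Qed.

Lemma KB f g : K f -> K g -> K (f \- g).
Proof. by move=> fK gK; rewrite fun_subE; apply: KD => //; exact: KZ. Qed.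

Definition bounded_model_space : set (R -> R[i]) := [set f | K f /\ Linf f].

Local Notation Kinf := bounded_model_space.

Lemma KinfD f g : Kinf f -> Kinf g -> Kinf (f \+ g).
Proof. by move=> [? ?] [? ?]; split; [exact: KD|exact: LinfD]. Qed.

Lemma KinfZ c f : Kinf f -> Kinf (cst c \* f).
Proof. by move=> [? ?]; split; [exact: KZ|exact: LinfM]. Qed.

(** This is the projection of [z f] on [K] when [f] is in [K]: then [z f] is
    orthogonal to [theta z H2], hence only its component along [theta] lies
    outside [K]. *)
Definition compressed_shift f : R -> R[i] :=
  (mono 1 \* f) \- (cst (dotp (mono 1 \* f) theta) \* theta).

Lemma dotp_theta_thetaM h : H2 h -> dotp theta (theta \* h) = (ev0 h)^*.
Proof.
move=> hH; rewrite -[RHS]mul1r -dotp_cst_ev0// -(dotp_theta (L2_cst _) (H2_L2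
  hH)).
by rewrite (_ : theta \* cst 1 = theta)//; apply/funext => t /=; rewrite mulr1.
Qed.

Local Notation cshift := compressed_shift.

Lemma cshift_K f : K f -> K (cshift f).
Proof.
move=> fK; have fH := K_H2 fK; have zfH := H2_zeta fH.
have zf2 := H2_L2 zfH.
split; first by apply: H2B => //; exact: H2Z.
move=> g gH; have g2 := H2_L2 gH; have bH := H2_bshift gH; have b2 := H2_L2 bH.
have thg2 : L2 (theta \* g) by exact: L2M.
have zb2 : L2 (mono 1 \* (theta \* bshift g)).
  by apply: L2M => //; exact: L2M.
rewrite dotpBl// ?dotpZl//; last exact: L2Z.
rewrite dotp_theta_thetaM//.
have -> : theta \* g = (cst (ev0 g) \* theta) \+ (mono 1 \* (theta \* bshift
  g)).
  by rewrite {1}(bshiftK g); apply/funext => t /=; ring.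
rewrite dotpDr//; last exact: L2Z.
by rewrite dotp_monoMM (proj2 fK)// dotpZr// addr0 mulrC subrr.
Qed.

(** The backward shift is adjoint to multiplication by [z], which preserves
    [theta H2]; the subtracted constant is orthogonal to [theta z h], whose
    value at 0 is zero. *)
Lemma bshift_K f : K f -> K (bshift f).
Proof.
move=> fK; have fH := K_H2 fK; have bH := H2_bshift fH; split => // h hH.
have h2 := H2_L2 hH; have th2 : L2 (theta \* h) by exact: L2M.
have zh := H2_zeta hH; have f2 := H2_L2 fH.
rewrite bshiftE dotp_mull monoJ opprK.
have -> : mono 1 \* (theta \* h) = theta \* (mono 1 \* h).
  by apply/funext => t /=; ring.
have thzH := H2_thetaM zh; have thz2 := H2_L2 thzH.
rewrite dotpBl// (proj2 fK _ zh) dotp_cst_ev0//.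
have -> : theta \* (mono 1 \* h) = mono 1 \* (theta \* h).
  by apply/funext => t /=; ring.
by rewrite ev0_zeta ?rmorph0 ?mulr0 ?subrr//; exact: H2_thetaM.
Qed.

Lemma ev0_thetaM h : H2 h -> ev0 (theta \* h) = ev0 theta * ev0 h.
Proof.
move=> hH; rewrite -mean_mul_H2// ev0E fourierE mono0 !dotpE.
by congr mean; apply/funext => t; rewrite /conjf /= conjCK rmorph1 mulr1.
Qed.

Lemma model_kernel0E :
  model_kernel0 theta = cst 1 \- (cst (ev0 theta)^* \* theta).
Proof. by []. Qed.

(** The constant 1 and [conj(theta(0)) theta] have the same inner product
    [conj(theta(0) h(0))] with [theta h]. *)
Lemma kernel0_Kinf : Kinf (model_kernel0 theta).
Proof.
rewrite model_kernel0E; split; last first.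
  by apply: LinfB => //; exact: LinfM.
split; first by apply: H2B; [exact: H2_cst|exact: H2Z].
move=> h hH; have thh := H2_thetaM hH; have thh2 := H2_L2 thh.
rewrite dotpBl//; last exact: L2Z.
by rewrite dotpZl// dotp_cst_ev0// dotp_theta_thetaM// ev0_thetaM// rmorphM
  mul1r subrr.
Qed.

Lemma conj_kernel0_Kinf : Kinf (model_conj_kernel0 theta).
Proof.
rewrite /model_conj_kernel0; split; last first.
  by rewrite bshiftE; apply: LinfM => //; exact: LinfB.
split; first exact: H2_bshift.
move=> h hH; have zh := H2_zeta hH; have thzh2 := H2_L2 (H2_thetaM zh).
rewrite bshiftE dotp_mull monoJ opprK.
have -> : mono 1 \* (theta \* h) = theta \* (mono 1 \* h).
  by apply/funext => t /=; ring.
rewrite dotpBl// dotp_theta_thetaM// ev0_zeta// rmorph0 dotp_cst_ev0;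
  last exact: H2_thetaM.
by rewrite ev0_thetaM// ev0_zeta// mulr0 rmorph0 mulr0 subrr.
Qed.

(** The antilinear isometric involution of [K] under which truncated Toeplitz
    operators are symmetric; it exchanges the two kernels at 0. *)
Definition model_conjugation f : R -> R[i] := theta \* conjf (mono 1 \* f).

(** Conjugation exchanges the two conditions that define [K]: [C f] is in [H2]
    because [f] is orthogonal to [theta H2], and [C f] is orthogonal to
    [theta g] because [z f g] has mean zero for [f] and [g] in [H2]. *)
Lemma model_conjugation_Kinf f : Kinf f -> Kinf (model_conjugation f).
Proof.
move=> [fK fb]; have fH := K_H2 fK; have f2 := H2_L2 fH.
have zfb : Linf (mono 1 \* f) by exact: LinfM.
have Cb : Linf (model_conjugation f) by apply: LinfM => //; exact: LinfJ.
have C2 := Linf_L2 Cb; split => //; split.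
  split => // n n0; rewrite fourierE.
  have [m En] : exists m : nat, - n - 1 = m%:Z by exists (absz (- n - 1)); lia.
  have thm2 : L2 (theta \* mono m%:Z) by exact: L2M.
  have -> : dotp (model_conjugation f) (mono n) = (dotp f (theta \* mono
    m%:Z))^*.
    rewrite -(dotpC f2 thm2) -En !dotpE monoJ -monoD -[mono (-1)]monoJ.
    congr mean; apply/funext => t.
    by rewrite /model_conjugation /conjf /= rmorphM; ring.
  by rewrite (proj2 fK) ?rmorph0//; exact: H2_mono.
move=> g gH; have g2 := H2_L2 gH.
have Jzf2 : L2 (conjf (mono 1 \* f)) by apply: L2J; exact: L2M.
rewrite dotp_theta// (dotpC g2 Jzf2) mean_mul_H2//; last exact: H2_zeta.
by rewrite ev0_zeta// mulr0 rmorph0.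
Qed.

Lemma ev0_kernel0 : ev0 (model_kernel0 theta) = 1 - (normc (ev0 theta) ^+ 2)%:C.
Proof.
rewrite model_kernel0E fun_subE ev0D//; last by do 2 apply: L2Z.
rewrite ev0_cst !ev0Z//; last exact: L2Z.
by rewrite mulN1r -mulJc mulrC.
Qed.

Lemma N2_inner : N2 theta = 1.
Proof.
apply: complexI; rewrite -dotpff -[RHS]mean_cst; apply: mean_ae.
- by have [] := L1_dot theta_L2 theta_L2.
- exact: mcfun_cst.
- case: theta_inner => _; apply: ae_imply => t /[apply] th1.
  by rewrite mulJc th1 expr1n.
Qed.

(** Here [|theta(0)| = 1].  As [theta] has norm 1, it has no other Fourier
    coefficient, so it is constant and [theta H2 = H2]. *)
Lemma model_space_trivial f : ev0 (model_kernel0 theta) = 0 -> K f -> N2 f = 0.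
Proof.
rewrite ev0_kernel0 => /eqP.
rewrite subr_eq0 => /eqP/complexI th0 fK.
have fH := K_H2 fK; have f2 := H2_L2 fH.
set a := ev0 theta in th0; pose r := theta \- cst a.
have r2 : L2 r by exact: L2B.
have ra : dotp (cst a) r = 0.
  rewrite dotp_cst_ev0; last by apply: H2B => //; exact: H2_cst.
  rewrite /r fun_subE ev0D//; last exact: L2Z.
  by rewrite ev0Z// ev0_cst mulN1r subrr rmorph0 mulr0.
have Nr : N2 r = 0.
  have := N2D_orth (L2_cst a) r2 ra.
  rewrite (_ : _ \+ r = theta); last by apply/funext => t;
    rewrite /r /= addrC subrK.
  have -> : N2 (cst a) = 1.
    apply: complexI; rewrite -dotpff dotp_cst_ev0; last exact: H2_cst.
    by rewrite ev0_cst mulJc -th0.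
  by rewrite N2_inner; lra.
apply: complexI; rewrite -dotpff; apply: H2_orth => // n.
have n2 := L2_mono R n%:Z.
rewrite (dotpC f2 n2); apply/eqP; rewrite conjC_eq0; apply/eqP.
have := proj2 fK _ (H2_mono R n).
have rn2 : L2 (mono n%:Z \* r) by exact: L2M.
have -> : theta \* mono n%:Z = (cst a \* mono n%:Z) \+ (mono n%:Z \* r).
  by apply/funext => t; rewrite /r /=; ring.
rewrite dotpDr//; last exact: L2Z.
rewrite dotpZr// (dotpC rn2 f2) (dotp_N2_0 rn2 f2) ?rmorph0 ?addr0.
  move=> /eqP; rewrite mulf_eq0 conjC_eq0 => /orP[/eqP a0|/eqP//].
  by move: th0; rewrite a0 normc0 expr0n => /eqP; rewrite oner_eq0.
apply: complexI; rewrite -dotpff dotp_monoMM dotpff Nr.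
by [].
Qed.

End model_space_theory.

(** * The kernel at 0 is cyclic for the compressed shift *)

Section cyclicity.
Variable R : realType.
Variable theta : R -> R[i].
Hypothesis theta_inner : inner_function theta.
Implicit Types (f g h u v p q F : R -> R[i]) (c z w : R[i]).
Local Notation K := (model_space theta).
Local Notation cshift := (compressed_shift theta).

Local Hint Resolve Linf_cst Linf_mono L2_mono L2_cst : core.
Local Hint Extern 0 (L2 _) => (apply: H2_L2; assumption) : core.
Local Hint Extern 0 (H2 _) => (apply: K_H2; eassumption) : core.
Local Hint Extern 0 (L2 _) => (apply: K_L2; eassumption) : core.

Variable V : set (R -> R[i]).
Hypothesis VD : forall f g, V f -> V g -> V (f \+ g).
Hypothesis VZ : forall c f, V f -> V (cst c \* f).
Hypothesis V_cshift : forall f, V f -> V (cshift f).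
Hypothesis V_kernel0 : V (model_kernel0 theta).

(** The relation [z^n = F + theta Q] gives [z^(n+1) = S F + theta (c + z Q)]
    with [c = <z F, theta>]. *)
Lemma analytic_poly_decomposition p : analytic_poly p ->
  exists F Q, [/\ V F, analytic_poly Q & p = F \+ (theta \* Q)].
Proof.
have poly_cst c : analytic_poly (cst c : R -> R[i]).
  by rewrite cst_mono0; exact: span_mono.
have monomial (n : nat) : exists F Q,
    [/\ V F, analytic_poly Q & mono n%:Z = F \+ (theta \* Q)].
  elim: n => [|n [F [Q [VF aQ nE]]]].
    exists (model_kernel0 theta), (cst (ev0 theta)^*); split => //.
    by rewrite mono0; apply/funext => t /=; rewrite /model_kernel0; ring.
  exists (cshift F), (cst (dotp (mono 1 \* F) theta) \+ (mono 1 \* Q)); split.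
  - exact: V_cshift.
  - apply: spanD; first exact: poly_cst.
    by apply: span_mulmono aQ => m m0; lia.
  - rewrite -addn1 PoszD addrC -monoD nE.
    by apply/funext => t; rewrite /compressed_shift /=; ring.
elim=> [c [n|n] // _|f g _ [F1 [Q1 [V1 a1 ->]]] _ [F2 [Q2 [V2 a2 ->]]]].
  have [F [Q [VF aQ ->]]] := monomial n.
  exists (cst c \* F), (cst c \* Q); split; [exact: VZ|exact: spanZ|].
  by apply/funext => t /=; ring.
exists (F1 \+ F2), (Q1 \+ Q2); split; [exact: VD|exact: spanD|].
by apply/funext => t /=; ring.
Qed.

(** If the polynomial [p = F + theta Q] is close to [f], then so is [F]: the
    difference [f - p] is the orthogonal sum of [f - F], which is in [K], and of
    [- theta Q]. *)
Lemma kernel0_cyclic f : (forall g, V g -> K g) -> K f -> adherent V f.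
Proof.
move=> VK fK e e0; have fH := K_H2 fK.
have [p [pa fp]] := analytic_poly_dense fH e0.
have [F [Q [VF aQ pE]]] := analytic_poly_decomposition pa.
exists F; split => //; apply: le_lt_trans fp.
have FK := VK _ VF; have fFK := KB theta_inner fK FK.
have QH := analytic_poly_H2 aQ; have thQ := H2_L2 (H2_thetaM theta_inner QH).
rewrite pE (_ : f \- (F \+ (theta \* Q)) = (f \- F) \+ (cst (-1) \* (theta \*
  Q))); last first.
  by apply/funext => t /=; ring.
have fF2 := K_L2 fFK.
have orth : dotp (f \- F) (cst (-1) \* (theta \* Q)) = 0.
  by rewrite dotpZr// (proj2 fFK) ?mulr0.
by rewrite (N2D_orth fF2 (L2Z (-1) thQ) orth) lerDl N2_ge0.
Qed.

End cyclicity.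

(** * The kernel of a truncated Toeplitz operator *)

Section kernel_of_TTO.
Variable R : realType.
Variables theta G : R -> R[i].
Hypothesis theta_inner : inner_function theta.
Hypothesis G_L2 : L2 G.
Implicit Types (f g h u v p q F : R -> R[i]) (c z w : R[i]).
Local Notation mu := (@lebesgue_measure R).
Local Notation T := (@circle R).
Local Notation K := (model_space theta).
Local Notation Kinf := (bounded_model_space theta).
Local Notation cshift := (compressed_shift theta).

Local Hint Resolve Linf_cst Linf_mono L2_mono L2_cst : core.
Local Hint Extern 0 (L2 _) => (apply: H2_L2; assumption) : core.
Local Hint Extern 0 (H2 _) => (apply: K_H2; eassumption) : core.
Local Hint Extern 0 (L2 _) => (apply: K_L2; eassumption) : core.

Let theta_H2 : H2 theta.
Proof. exact: inner_H2. Qed.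

Let theta_Linf : Linf theta.
Proof. exact: inner_Linf. Qed.

Let theta_L2 : L2 theta.
Proof. exact: H2_L2. Qed.

Let GL f : Linf f -> L2 (G \* f).
Proof. exact: L2Mr. Qed.

Local Hint Resolve theta_H2 theta_Linf theta_L2 : core.

Let dotpG f g : dotp (G \* f) g = dotp f (conjf G \* g).
Proof. exact: dotp_mull. Qed.

Let conjGL g : Linf g -> L2 (conjf G \* g).
Proof. by apply: L2Mr; exact: L2J. Qed.

(** The bounded functions that the operator, seen as a sesquilinear form on
    bounded functions, sends to zero. *)
Definition ker_form : set (R -> R[i]) :=
  [set f | Kinf f /\ forall g, Kinf g -> dotp (G \* f) g = 0].

(** When [f] is in the kernel as a limit of functions [f_n] with images
    [h_n -> 0], the inner product with a bounded [g] is continuous on both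
    sides: [<G f_n, g>] is [<f_n, conj(G) g>], with [conj(G) g] in [L2]. *)
Lemma ker_TTO_form f : Kinf f -> ker_TTO theta G f -> ker_form f.
Proof.
move=> fKb; have [fK fb] := fKb => fker; split => // g [gK gb].
have proj p h : TTO0 theta G p h -> [/\ L2 p,
  L2 h & dotp (G \* p) g = dotp h g].
  move=> [pK /HinfE[_ pb] [hK] /(_ g gK)]; rewrite dotpBl//; last first.
  - exact: GL.
  by move=> /eqP; rewrite subr_eq0 => /eqP ?; split.
have dot0 : dotp (fun=> 0) g = 0.
  rewrite (_ : (fun=> 0) = cst 0 \* g); last by apply/funext => t /=;
    rewrite mul0r.
  by rewrite dotpZl// mul0r.
case: fker => [/proj[_ _ ->]//|[_ _ _ [f_ [h_ [fh ff hh]]]]].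
apply: eq0_normc; apply/eqP; rewrite eq_le normc_ge0 andbT.
apply/ler_addgt0Pr => e e0; rewrite add0r.
have e2 : 0 < e / 2 by rewrite divr_gt0.
have near_small (a_ : nat -> R -> R[i]) (a : R -> R[i]) v : L2 v -> L2 a ->
    (forall n, L2 (a_ n)) -> L2cvg a_ a ->
    \forall n \near \oo, normc (dotp (a_ n \- a) v) < e / 2.
  move=> v2 a2 a_2 aa; have [d d0 small] := dotp_small v2 e2.
  have sd : 0 < Num.sqrt d by rewrite sqrtr_gt0.
  move/cvgrPdist_lt : aa => /(_ _ sd); apply: filterS => n.
  rewrite sub0r normrN ger0_norm ?sqrtr_ge0// => nd.
  apply: small; first exact: L2B.
  by rewrite -N2_L2norm -[ltRHS]sqr_sqrtr ?ltW// ltr_pXn2r ?nnegrE ?sqrtr_ge0.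
have f_2 n : L2 (f_ n) by have [] := proj _ _ (fh n).
have h_2 n : L2 (h_ n) by have [] := proj _ _ (fh n).
have [n [fn hn]] : exists n, normc (dotp (f_ n \- f) (conjf G \* g)) < e / 2 /\
    normc (dotp (h_ n \- fun=> 0) g) < e / 2.
  have s1 := near_small _ _ _ (conjGL gb) (K_L2 fK) f_2 ff.
  have s2 := near_small _ _ _ (K_L2 gK) (L2_cst (0 : R[i])) h_2 hh.
  have [n _ /(_ n (leqnn n))] := filterI s1 s2.
  by exists n.
have [_ _ phn] := proj _ _ (fh n).
have -> : dotp (G \* f) g =
    dotp (h_ n \- fun=> 0) g - dotp (f_ n \- f) (conjf G \* g).
  rewrite (dotpBl (h_2 n) (L2_cst (0 : R[i])) (K_L2 gK)) dot0 subr0.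
  rewrite (dotpBl (f_2 n) (K_L2 fK) (conjGL gb)) -!dotpG phn.
  by rewrite opprB addrC subrK.
apply: le_trans (le_normcD _ _) _; rewrite normcN [leRHS](splitr e).
by apply: lerD; exact: ltW.
Qed.

Lemma ker_formD f g : ker_form f -> ker_form g -> ker_form (f \+ g).
Proof.
move=> [fK f0] [gK g0]; have [_ fb] := fK; have [_ gb] := gK.
split=> [|h hK]; first exact: KinfD.
have [hK' hb] := hK; rewrite !dotpG dotpDl//;
  [|exact: Linf_L2|exact: Linf_L2|exact: conjGL].
by rewrite -!dotpG f0// g0// addr0.
Qed.

Lemma ker_formZ c f : ker_form f -> ker_form (cst c \* f).
Proof.
move=> [fK f0]; have [_ fb] := fK.
split=> [|h hK]; first exact: KinfZ.
have [hK' hb] := hK; rewrite !dotpG dotpZl//; [|exact: Linf_L2|exact: conjGL].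
by rewrite -!dotpG f0// mulr0.
Qed.

Hypothesis ker_k0 : ker_form (model_kernel0 theta).
Hypothesis ker_tk0 : ker_form (model_conj_kernel0 theta).

(** With [C = model_conjugation theta], the functions [F conj(k0)] and
    [k1 conj(C F)] agree wherever [|theta| = 1], where [k0] and [k1] are
    [model_kernel0 theta] and [model_conj_kernel0 theta]. *)
Lemma form_kernel0 F : Kinf F -> dotp (G \* F) (model_kernel0 theta) = 0.
Proof.
move=> FK; have CK := model_conjugation_Kinf theta_inner FK.
have [_ tb] := (conj_kernel0_Kinf theta_inner).
have [_ kb] := (kernel0_Kinf theta_inner).
rewrite -[RHS](proj2 ker_tk0 _ CK).
have [_ Cb] := CK; have [_ Fb] := FK.
apply: dotp_ae; [exact: GL|exact: Linf_L2|exact: GL|exact: Linf_L2|].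
case: theta_inner => _; apply: ae_imply => t /[apply] th1.
have thJ : theta t * (theta t)^* = 1 by rewrite mulJc th1 expr1n.
rewrite /model_conj_kernel0 /model_kernel0 /bshift /model_conjugation /conjf /=.
rewrite mono1 !rmorphM /= !rmorphB rmorph1 !rmorphM /= !conjCK.
have := zeta_neq0 t; move: (zeta t) (theta t) thJ (ev0 theta) => z th thJ c z0.
rewrite -[X in X - _]thJ; field.
exact: z0.
Qed.

(** In [g = g(0) + z S^* g], the second term contributes
    [<G z f, z S^* g> = <G f, S^* g> = 0]. *)
Lemma form_zeta f g : ker_form f -> Kinf g ->
  dotp (G \* (mono 1 \* f)) g = (ev0 g)^* * dotp (G \* (mono 1 \* f)) (cst 1).
Proof.
move=> [[fK fb] f0] [gK gb].
have zfb : Linf (mono 1 \* f) by exact: LinfM.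
have Gzf := GL zfb.
have bK := bshift_K theta_inner gK.
have bb : Linf (bshift g) by rewrite bshiftE; apply: LinfM => //; exact: LinfB.
have b2 := K_L2 bK.
have -> : (ev0 g)^* * dotp (G \* (mono 1 \* f)) (cst 1) =
    dotp (G \* (mono 1 \* f)) (cst (ev0 g)).
  rewrite -dotpZr// (_ : cst _ \* cst 1 = cst (ev0 g))//.
  by apply/funext => t /=; rewrite mulr1.
rewrite [in LHS](bshiftK g) dotpDr//; last exact: L2M.
rewrite -[RHS]addr0; congr (_ + _).
have -> : G \* (mono 1 \* f) = mono 1 \* (G \* f).
  by apply/funext => t /=; ring.
by rewrite dotp_monoMM f0.
Qed.

(** By [form_zeta], and by [Gth] for the term in [theta] of the compressed
    shift, [<G (S f), g>] is [conj(g(0))] times a constant [gamma].  Taking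
    [g = model_kernel0 theta], where [form_kernel0] applies, shows that
    [gamma = 0]. *)
Lemma cshift_ker f : ev0 (model_kernel0 theta) != 0 -> ker_form f ->
  ker_form (cshift f).
Proof.
set d := ev0 (model_kernel0 theta) => d0 fker; have [[fK fb] f0] := fker.
have zfb : Linf (mono 1 \* f) by exact: LinfM.
have SK : Kinf (cshift f).
  by split; [exact: cshift_K|apply: LinfB => //; exact: LinfM].
pose beta F := dotp (G \* (mono 1 \* F)) (cst 1).
have tkb : Linf (model_conj_kernel0 theta) by case: ker_tk0 => -[].
have ztkb : Linf (mono 1 \* model_conj_kernel0 theta) by exact: LinfM.
have kb : Linf (model_kernel0 theta) by case: ker_k0 => -[].
(* obtained by eliminating [<G, g>] between [G1] and [G2] *)
have Gth g : Kinf g -> d * dotp (G \* theta) g =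
    (ev0 g)^* * beta (model_conj_kernel0 theta).
  move=> gK; have [gK' gb] := gK; have g2 := K_L2 gK'.
  rewrite -form_zeta//.
  have Gk := proj2 ker_k0 g gK.
  have G1 : dotp (G \* theta) g = ev0 theta * dotp (G \* cst 1) g +
      dotp (G \* (mono 1 \* model_conj_kernel0 theta)) g.
    have -> : G \* theta = (cst (ev0 theta) \* (G \* cst 1)) \+
        (G \* (mono 1 \* model_conj_kernel0 theta)).
      apply/funext => t.
      by rewrite /= [in LHS](bshiftK theta) /= /model_conj_kernel0; ring.
    rewrite dotpDl//; [|by apply: L2Z; exact: GL|exact: GL].
    by rewrite dotpZl//; exact: GL.
  have G2 : dotp (G \* model_kernel0 theta) g =
      dotp (G \* cst 1) g - (ev0 theta)^* * dotp (G \* theta) g.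
    have -> : G \* model_kernel0 theta =
        (G \* cst 1) \- (cst (ev0 theta)^* \* (G \* theta)).
      by apply/funext => t; rewrite /model_kernel0 /=; ring.
    rewrite dotpBl//; [|exact: GL|by apply: L2Z; exact: GL].
    by rewrite dotpZl//; exact: GL.
  move: Gk; rewrite G2 => /eqP; rewrite subr_eq0 => /eqP G3.
  rewrite /d (ev0_kernel0 theta_inner) -mulJc mulrBl mul1r {1}G1 G3; ring.
pose gamma := beta f - dotp (mono 1 \* f) theta * (beta (model_conj_kernel0
  theta) / d).
have GS g : Kinf g -> dotp (G \* cshift f) g = (ev0 g)^* * gamma.
  move=> gK; have [gK' gb] := gK; have g2 := K_L2 gK'.
  have -> : G \* cshift f = (G \* (mono 1 \* f)) \-
      (cst (dotp (mono 1 \* f) theta) \* (G \* theta)).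
    by apply/funext => t; rewrite /compressed_shift /=; ring.
  rewrite dotpBl//; [|exact: GL|by apply: L2Z; exact: GL].
  rewrite dotpZl//; last exact: GL.
  rewrite form_zeta// -/(beta f).
  have -> : dotp (G \* theta) g = (ev0 g)^* * (beta (model_conj_kernel0 theta)
    / d).
    by apply: (mulfI d0); rewrite Gth//; field.
  by rewrite /gamma; ring.
split=> // g gK; rewrite GS//.
have := form_kernel0 SK; rewrite GS; last by case: ker_k0.
move=> /eqP; rewrite mulf_eq0 conjC_eq0 (negbTE d0) /= => /eqP ->.
by rewrite mulr0.
Qed.

(** The case that [cshift_ker] leaves out is that of a zero model space. *)
Lemma ker_form_cshift f : ker_form f -> ker_form (cshift f).
Proof.
have [d0|d0] := eqVneq (ev0 (model_kernel0 theta)) 0; last exact: cshift_ker.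
move=> [[fK fb] _]; have SK := cshift_K theta_inner fK.
split=> [|g [gK gb]].
  by split=> //; apply: LinfB; [exact: LinfM|apply: LinfM].
rewrite dotp_mull; apply: (dotp_N2_0 (K_L2 SK) (conjGL gb)).
exact: model_space_trivial SK.
Qed.

Lemma ker_form_dense f : K f -> adherent ker_form f.
Proof.
apply: (kernel0_cyclic theta_inner ker_formD ker_formZ ker_form_cshift ker_k0).
by move=> g [[]].
Qed.

(** Density of [ker_form] is used twice: for bounded [g], where it extends
    [B f g = 0] from [f] in [ker_form] to any bounded [f], and then to reach
    any [g]. *)
Lemma form_eq0 f g : Kinf f -> K g -> dotp (G \* f) g = 0.
Proof.
move=> [fK fb] gK; have Gf2 := GL fb; have g2 := K_L2 gK.
rewrite (dotpC g2 Gf2) (dotp_adherent g2 Gf2 (ker_form_dense gK)) ?rmorph0//.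
move=> p [[pK pb] pG]; have p2 := K_L2 pK; split=> //.
rewrite (dotpC Gf2 p2) dotpG.
rewrite (dotp_adherent (K_L2 fK) (conjGL pb) (ker_form_dense fK)) ?rmorph0//.
move=> q [[qK qb] q0]; split; first exact: K_L2 qK.
by rewrite -dotpG; exact: q0.
Qed.

Lemma TTO0_eq0 f : Kinf f -> TTO0 theta G f (fun=> 0).
Proof.
move=> fKb; have [fK fb] := fKb; split; first exact: fK.
  by apply/HinfE; split; [exact: K_H2 fK|exact: fb].
split; first exact: K0.
move=> g gK; rewrite (_ : _ \- _ = G \* f); first exact: form_eq0.
by apply/funext => t /=; rewrite subr0.
Qed.

(** All the values of the operator are zero: [h] is the projection of [G p],
    hence orthogonal to itself by [form_eq0]. *)
Lemma TTO0_bounded : TTO_bounded theta G.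
Proof.
exists 0 => p h [pK /HinfE[_ pb] [hK /(_ h hK)]].
rewrite (dotpBl (GL pb) (K_L2 hK) (K_L2 hK)) form_eq0// sub0r dotpff.
move=> /eqP; rewrite oppr_eq0 => /eqP/complexI Nh.
by rewrite mul0r /L2norm -/(N2 h) Nh sqrtr0.
Qed.

(** Unbounded functions are reached as limits of functions of [ker_form], whose
    images are all 0. *)
Lemma ker_TTO_all f : K f -> ker_TTO theta G f.
Proof.
move=> fK; right; split; [exact: TTO0_bounded|exact: fK|exact: K0|].
have /choice[f_ Hf_] : forall n : nat,
    exists p, ker_form p /\ N2 (f \- p) < n.+1%:R^-1.
  by move=> n; apply: (ker_form_dense fK); rewrite invr_gt0.
have Kf_ n : Kinf (f_ n) by case: (Hf_ n) => -[].
exists f_, (fun=> fun=> 0); split.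
- by move=> n; exact: TTO0_eq0.
- apply/cvgrPdist_lt => e e0.
  have e20 : 0 < e ^+ 2 by rewrite exprn_gt0.
  have [N _ NH] := near_infty_natSinv_lt (PosNum e20).
  exists N => // n /NH /= nlt; rewrite sub0r normrN ger0_norm ?sqrtr_ge0//.
  rewrite -(@ltr_pXn2r _ 2) ?nnegrE ?sqrtr_ge0 ?ltW// N2_L2norm.
  apply: lt_trans nlt.
  have [_] := Hf_ n; rewrite (_ : f_ n \- f = cst (-1) \* (f \- f_ n)).
    rewrite N2Z; last exact: L2B (K_L2 fK) (K_L2 (proj1 (Kf_ n))).
    by rewrite normcN normc1 expr1n mul1r.
  by apply/funext => t /=; ring.
- rewrite /L2cvg (_ : (fun n => _) = fun=> 0); first exact: cvg_cst.
  apply/funext => n; rewrite /L2norm -/(N2 _) N2_eq0 ?sqrtr0// => t _ /=.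
  by rewrite subrr.
Qed.

End kernel_of_TTO.

Theorem corollary3p10 (R : realType) (theta G : R -> R[i])
  (theta_inner : inner_function theta) (G_L2 : L2 G)
  (ker_k0 : ker_TTO theta G (model_kernel0 theta))
  (ker_tk0 : ker_TTO theta G (model_conj_kernel0 theta)) :
  ker_TTO theta G = model_space theta.
Proof.
apply/seteqP; split=> f; first by case=> [[]|[]].
have Vk := ker_TTO_form G_L2 (kernel0_Kinf theta_inner) ker_k0.
have Vtk :=
  ker_TTO_form G_L2 (conj_kernel0_Kinf theta_inner) ker_tk0.
exact: ker_TTO_all.
Qed.
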